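(* There exists an absolute constant $\gamma_0>0$ such that for every constant $\epsilon\in(0,1)$ the following holds. Let $m,d$ be growing parameters with $d>m(1-\gamma_0)$ (and $m-d\to\infty$), and let $K=(1-\epsilon)\binom{m}{\le m-d-1}$ (rounded to an integer). If $Z\subseteq\mathbb{F}_2^m$ is a uniformly random set of $K$ coordinates, then with probability $1-o(1)$ the code $\operatorname{RM}(m,d)$ can recover from erasure of the coordinates in $Z$; that is, no two distinct codewords of $\operatorname{RM}(m,d)$ agree on all coordinates of $\mathbb{F}_2^m\setminus Z$ (equivalently, no nonzero codeword is supported inside $Z$).
   Context: $\binom{m}{\le s}=\sum_{j=0}^{s}\binom{m}{j}$. The Reed–Muller code $\operatorname{RM}(m,d)\subseteq\mathbb{F}_2^{2^m}$ is the set of evaluation vectors, over all points of $\mathbb{F}_2^m$, of multilinear polynomials in $\mathbb{F}_2[x_1,\ldots,x_m]$ of degree at most $d$; coordinates are indexed by $\mathbb{F}_2^m$. *)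

(* Defs.v *)
From HB Require Import structures.
From mathcomp Require Import all_boot all_order all_algebra.
From mathcomp Require Import reals.
Set Implicit Arguments. Unset Strict Implicit. Unset Printing Implicit Defensive.
Import Order.TTheory GRing.Theory Num.Theory.

Definition binom_le (m s : nat) : nat := \sum_(j < s.+1) 'C(m, j).

Definition point (m : nat) := 'rV['F_2]_m.

Definition RM_eval (m d : nat) (c : {ffun {set 'I_m} -> 'F_2})
  : {ffun point m -> 'F_2} :=
  [ffun x : point m =>
     \sum_(S : {set 'I_m} | (#|S| <= d)%N) c S * \prod_(i in S) x ord0 i]%R.

Definition RM (m d : nat) : {set {ffun point m -> 'F_2}} :=
  [set RM_eval d c | c : {ffun {set 'I_m} -> 'F_2}].

Definition erasure_recoverable (m d : nat) (Z : {set point m}) : bool :=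
  [forall w1 in RM m d, forall w2 in RM m d,
     [forall x in ~: Z, w1 x == w2 x] ==> (w1 == w2)].

Definition prob_recoverable (R : realType) (m d K : nat) : R :=
  ((#|[set Z : {set point m} | (#|Z| == K) && erasure_recoverable d Z]|)%:R
   / (#|[set Z : {set point m} | #|Z| == K]|)%:R)%R.

Definition K_of (R : realType) (eps : R) (m d : nat) : nat :=
  `| Num.floor ((1 - eps) * (binom_le m (m - d - 1))%:R) |%N.

(* Main.v *)
Require Import Defs.
From HB Require Import structures.
From mathcomp Require Import all_boot all_order all_algebra.
From mathcomp Require Import reals zify ring lra.
Import Order.TTheory GRing.Theory Num.Theory.
Local Open Scope ring_scope.
Set Implicit Arguments. Unset Strict Implicit. Unset Printing Implicit Defensive.

(* Let r = m - d - 1 and C = RM(m,r), which is orthogonal to RM(m,d), and let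
   D = log2 |C|.  If X_Z counts the words of C vanishing on Z, then
   |C| <= 2^|Z| X_Z, with a factor 2 to spare when Z is not recoverable.
   Hence the failure probability is at most E_f (1 + beta_f)^K - 1, where f is
   uniform in C and beta_f is its bias; it remains to bound the number of words
   of C of large bias, down to bias 2^-(m/10), which is o(1/K).
   Words of low weight: if f has weight at most 2^-k', the product of two
   k-fold derivatives of f in random directions, with 2k + 3 <= k', is f up to
   a word of weight 2^-(k'+2); there are few such derivatives because they have
   degree r - k, so one can recurse on k'.
   Words of bias at least 2^-l: by Chebyshev, on most cosets of a random
   subspace of dimension t slightly above 2l the word f takes the value 0 more
   often than 1, so that, up to a word of low weight, f is determined by its
   class modulo the words invariant under the subspace, of which there are
   2^(D(m-t,r)). *)

Local Notation fn m := {ffun point m -> 'F_2}.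

(** * Reed-Muller codes as polynomial functions *)

Lemma card_point m : #|{: point m}| = (2 ^ m)%N.
Proof. by rewrite card_mx card_Fp // mul1n. Qed.

Lemma F2P (a : 'F_2) : a = 0 \/ a = 1.
Proof. case: a => [[|[|n]] lt_n] //; [left|right]; exact/val_inj. Qed.

Lemma F2_neq0 (a : 'F_2) : (a != 0) = (a == 1).
Proof. by case: (F2P a) => ->. Qed.

Lemma F2D (a : 'F_2) : a + a = 0.
Proof. by case: (F2P a) => ->; apply/val_inj. Qed.

Lemma fnD m (f : fn m) : f + f = 0.
Proof. by apply/ffunP => x; rewrite !ffunE F2D. Qed.

Lemma fnN m (f : fn m) : - f = f.
Proof. by apply/eqP; rewrite -subr_eq0 -opprD fnD oppr0. Qed.

Lemma pointD m (x : point m) : x + x = 0.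
Proof. by apply/rowP => i; rewrite !mxE F2D. Qed.

Lemma RM_evalE m d c (x : point m) : RM_eval d c x =
  \sum_(S : {set 'I_m} | (#|S| <= d)%N) c S * \prod_(i in S) x ord0 i.
Proof. by rewrite ffunE. Qed.

Lemma RM_evalD m d (c c' : {ffun {set 'I_m} -> 'F_2}) :
  RM_eval d (c + c') = RM_eval d c + RM_eval d c'.
Proof.
apply/ffunP => x; rewrite !ffunE -big_split; apply: eq_bigr => S _ /=.
by rewrite !ffunE mulrDl.
Qed.

Lemma RM_evalP m d (f : fn m) : reflect (exists c, f = RM_eval d c) (f \in RM m d).
Proof. by apply: (iffP imsetP) => [[c _ ->]|[c ->]]; exists c. Qed.

Lemma RM0 m d : 0 \in RM m d.
Proof.
apply/RM_evalP; exists 0; apply/ffunP => x.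
by rewrite !ffunE big1 // => S _; rewrite ffunE mul0r.
Qed.

Lemma RMD m d (f g : fn m) : f \in RM m d -> g \in RM m d -> f + g \in RM m d.
Proof.
move=> /RM_evalP[c ->] /RM_evalP[c' ->]; apply/RM_evalP; exists (c + c').
by rewrite RM_evalD.
Qed.

Lemma RM_sum m d (I : Type) (s : seq I) (P : pred I) (F : I -> fn m) :
  (forall i, P i -> F i \in RM m d) -> \sum_(i <- s | P i) F i \in RM m d.
Proof. by move=> h; apply: (big_ind (fun f => f \in RM m d)) => //; [exact: RM0 | exact: RMD]. Qed.

Lemma RM_monomial m d (a : 'F_2) (S : {set 'I_m}) : (#|S| <= d)%N ->
  [ffun x : point m => a * \prod_(i in S) x ord0 i] \in RM m d.
Proof.
move=> leSd; apply/RM_evalP; exists [ffun T => if T == S then a else 0].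
apply/ffunP => x; rewrite !ffunE (bigD1 S) //= ffunE eqxx [X in _ + X]big1 ?addr0 //.
by move=> T /andP[_ /negPf neTS]; rewrite ffunE neTS mul0r.
Qed.

(* A basis-free description of the code, stable under differences and under
   linear substitutions. *)
Inductive deg_le m : nat -> fn m -> Prop :=
| Deg_const c : deg_le 0 [ffun => c]
| Deg_widen r f : deg_le r f -> deg_le r.+1 f
| Deg_add r f g : deg_le r f -> deg_le r g -> deg_le r (f + g)
| Deg_mul r f (a : 'cV['F_2]_m) b : deg_le r f ->
    deg_le r.+1 [ffun x => ((x *m a) ord0 ord0 + b) * f x].

Lemma deg_le_leq m r s (f : fn m) : (r <= s)%N -> deg_le r f -> deg_le s f.
Proof.
move=> /subnK <-; elim: (s - r)%N => // k IH hf.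
by rewrite addSn; apply: Deg_widen; apply: IH.
Qed.

Lemma deg_le_const m r c : @deg_le m r [ffun => c].
Proof. by apply: (@deg_le_leq _ 0) => //; constructor. Qed.

Lemma deg_le0 m r : @deg_le m r 0.
Proof.
rewrite (_ : 0 = [ffun => 0]); first exact: deg_le_const.
by apply/ffunP => x; rewrite !ffunE.
Qed.

Lemma deg_le_sum m r (I : Type) (s : seq I) (P : pred I) (F : I -> fn m) :
  (forall i, P i -> deg_le r (F i)) -> deg_le r (\sum_(i <- s | P i) F i).
Proof.
move=> h; apply: (big_ind (@deg_le m r)) => //; [exact: deg_le0 | exact: Deg_add].
Qed.

Lemma deg_le_monomial m a (s : seq 'I_m) :
  deg_le (size s) [ffun x : point m => a * \prod_(i <- s) x ord0 i].
Proof.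
elim: s => [|i s IH].
  rewrite (_ : [ffun _ => _] = [ffun => a]); first exact: Deg_const.
  by apply/ffunP => x; rewrite !ffunE big_nil mulr1.
rewrite (_ : [ffun _ => _] =
  [ffun x : point m => ((x *m (delta_mx i ord0 : 'cV_m)) ord0 ord0 + 0) *
     [ffun x : point m => a * \prod_(i <- s) x ord0 i] x]).
  exact: Deg_mul.
apply/ffunP => x; rewrite !ffunE big_cons addr0 mulrCA; congr (_ * _).
rewrite mxE (bigD1 i) //= mxE !eqxx mulr1 big1 ?addr0 // => j /negPf neq.
by rewrite mxE neq mulr0.
Qed.

Lemma RM_deg_le m r (f : fn m) : f \in RM m r -> deg_le r f.
Proof.
move=> /RM_evalP[c ->].
rewrite (_ : RM_eval r c = \sum_(S : {set 'I_m} | (#|S| <= r)%N)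
   [ffun x : point m => c S * \prod_(i in S) x ord0 i]); last first.
  by apply/ffunP => x; rewrite !ffunE sum_ffunE; apply: eq_bigr => S _; rewrite ffunE.
apply: deg_le_sum => S leSr; apply: (deg_le_leq leSr).
rewrite cardE (_ : [ffun _ => _] =
  [ffun x : point m => c S * \prod_(i <- enum S) x ord0 i]); first exact: deg_le_monomial.
by apply/ffunP => x; rewrite !ffunE big_enum.
Qed.

(** Since [x_i ^ 2 = x_i] over F_2, multiplication by [x_i] turns the monomial of [S] into that of
    [i |: S]. *)
Lemma RM_mul_coord m r (f : fn m) i : f \in RM m r ->
  [ffun x : point m => x ord0 i * f x] \in RM m r.+1.
Proof.
move=> /RM_evalP[c ->].
rewrite (_ : [ffun _ => _] = \sum_(S : {set 'I_m} | (#|S| <= r)%N)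
   [ffun x : point m => c S * \prod_(j in i |: S) x ord0 j]); last first.
  apply/ffunP => x; rewrite !ffunE sum_ffunE mulr_sumr; apply: eq_bigr => S _.
  rewrite !ffunE mulrCA; congr (_ * _).
  have [iS|niS] := boolP (i \in S); last by rewrite big_setU1.
  rewrite (setUidPr _) ?sub1set // (bigD1 i) //= mulrA; congr (_ * _).
  by case: (F2P (x ord0 i)) => ->; rewrite ?mulr0 ?mulr1.
apply: RM_sum => S leSr; apply: RM_monomial.
by rewrite cardsU1 (leq_trans (leq_add (leq_b1 _) leSr)).
Qed.

Lemma RM_widen m r (f : fn m) : f \in RM m r -> f \in RM m r.+1.
Proof.
move=> /RM_evalP[c ->].
rewrite (_ : RM_eval r c = \sum_(S : {set 'I_m} | (#|S| <= r)%N)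
   [ffun x : point m => c S * \prod_(i in S) x ord0 i]); last first.
  by apply/ffunP => x; rewrite !ffunE sum_ffunE; apply: eq_bigr => S _; rewrite ffunE.
by apply: RM_sum => S leSr; apply: RM_monomial; rewrite leqW.
Qed.

Lemma deg_leP m r (f : fn m) : deg_le r f <-> f \in RM m r.
Proof.
split; last exact: RM_deg_le.
elim=> {r f} [c|r f _ |r f g _ hf _ hg|r f a b _ hf].
- rewrite (_ : [ffun => c] = [ffun x : point m => c * \prod_(i in set0) x ord0 i]).
    by apply: RM_monomial; rewrite cards0.
  by apply/ffunP => x; rewrite !ffunE big_set0 mulr1.
- exact: RM_widen.
- exact: RMD.
- rewrite (_ : [ffun _ => _] = \sum_i
     [ffun x : point m => x ord0 i * [ffun x : point m => a i ord0 * f x] x]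
     + [ffun x : point m => b * f x]); last first.
    apply/ffunP => x; rewrite !ffunE mulrDl; congr (_ + _).
    rewrite mxE mulr_suml sum_ffunE; apply: eq_bigr => i _.
    by rewrite !ffunE mulrA.
  have hs c : [ffun x : point m => c * f x] \in RM m r.
    case: (F2P c) => ->.
      rewrite (_ : [ffun _ => _] = 0) ?RM0 //.
      by apply/ffunP => x; rewrite !ffunE mul0r.
    rewrite (_ : [ffun _ => _] = f) //; apply/ffunP => x; rewrite !ffunE mul1r //.
  apply: RMD; last exact/RM_widen/hs.
  by apply: RM_sum => i _; apply/RM_mul_coord/hs.
Qed.

Lemma card_subsets_le m d :
  #|[pred S : {set 'I_m} | (#|S| <= d)%N]| = binom_le m d.
Proof.
rewrite -sum1_card (partition_big (fun S : {set 'I_m} => inord #|S| : 'I_d.+1) predT) //=.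
apply: eq_bigr => j _; rewrite -[X in 'C(X, _)](card_ord m) -cardsT -cards_draws.
rewrite -sum1_card; apply: eq_bigl => S; rewrite !inE subsetT /=.
have [leSd|ltdS] := leqP #|S| d.
  by rewrite -val_eqE /= inordK.
by apply/esym/negbTE; apply: contraTneq ltdS => ->; rewrite -leqNgt -ltnS.
Qed.

(** Triangularity: at the indicator point of [S] only monomials of subsets of [S] survive, and the
    coefficients of proper subsets vanish by induction. *)
Lemma RM_eval_inj m d (c : {ffun {set 'I_m} -> 'F_2}) :
  RM_eval d c = 0 -> forall S : {set 'I_m}, (#|S| <= d)%N -> c S = 0.
Proof.
move=> c0 S; move: {2}#|S| (leqnn #|S|) => n; elim: n S => [|n IH] S leSn leSd.
all: have /ffunP/(_ (\row_i (i \in S)%:R)) := c0; rewrite !ffunE (bigD1 S) //=.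
all: rewrite [X in c S * X]big1 ?mulr1; last by move=> i iS; rewrite mxE iS.
all: rewrite big1 ?addr0 // => T /andP[leTd neTS].
all: have [sTS|/subsetPn[i iT niS]] := boolP (T \subset S);
  last by rewrite (bigD1 i) //= mxE (negPf niS) mul0r mulr0.
- have ltTS : (#|T| < #|S|)%N by rewrite proper_card // properEneq neTS.
  by move: ltTS; rewrite ltnNge (leq_trans leSn).
- have ltTS : (#|T| < #|S|)%N by rewrite proper_card // properEneq neTS.
  by rewrite IH ?mul0r // -ltnS (leq_trans ltTS).
Qed.

Lemma card_RM m d : #|RM m d| = (2 ^ binom_le m d)%N.
Proof.
pose B := [pred S : {set 'I_m} | (#|S| <= d)%N].
(* Coefficients of sets larger than [d] do not affect [RM_eval]; fixing them to 0 makes the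
   evaluation injective. *)
pose P : {set {ffun {set 'I_m} -> 'F_2}} := [set c in pffun_on 0 (mem B) predT].
have cardP : #|P| = (2 ^ binom_le m d)%N.
  rewrite cardsE card_pffun_on card_subsets_le; congr (_ ^ _)%N.
  by rewrite (_ : #|predT| = #|{: 'F_2}|) ?card_Fp //; apply: eq_card.
have PE c : c \in P -> forall S : {set 'I_m}, (d < #|S|)%N -> c S = 0.
  rewrite inE => /pffun_onP[/supportP sup _] S ltdS.
  by apply: sup; rewrite inE -ltnNge.
rewrite -cardP -(@card_in_imset _ _ (RM_eval d) P).
  apply/eqP; rewrite eqn_leq; apply/andP; split; apply: subset_leq_card.
    apply/subsetP => f /RM_evalP[c ->].
    pose c' := [ffun S : {set 'I_m} => if (#|S| <= d)%N then c S else 0].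
    rewrite (_ : RM_eval d c = RM_eval d c').
      apply: imset_f; rewrite inE; apply/pffun_onP; split => [|S //].
      by apply/supportP => S; rewrite inE ffunE => /negPf ->.
    by apply/ffunP => x; rewrite !ffunE; apply: eq_bigr => S; rewrite ffunE => ->.
  by apply/subsetP => _ /imsetP[c _ ->]; apply/RM_evalP; exists c.
move=> c c' cP c'P eqcc'; apply/ffunP => S; have [leSd|ltdS] := leqP #|S| d; last first.
  by rewrite !PE.
apply/eqP; rewrite -subr_eq0; apply/eqP.
have cc'0 : RM_eval d (c - c') = 0.
  apply: (addIr (RM_eval d c')); rewrite -RM_evalD subrK eqcc' add0r //.
by have := RM_eval_inj cc'0 leSd; rewrite !ffunE.
Qed.

(** * Derivatives, linear substitutions, products and orthogonality *)

Definition shift m (y : point m) (f : fn m) : fn m := [ffun x => f (x + y)].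
Definition diff m (y : point m) (f : fn m) : fn m := shift y f + f.

Lemma shiftD m (y : point m) (f g : fn m) : shift y (f + g) = shift y f + shift y g.
Proof. by apply/ffunP => x; rewrite !ffunE. Qed.

Lemma diffE m (y : point m) (f : fn m) x : diff y f x = f (x + y) + f x.
Proof. by rewrite !ffunE. Qed.

Lemma deg_le_shift m r (y : point m) (f : fn m) : deg_le r f -> deg_le r (shift y f).
Proof.
elim=> {r f} [c|r f _ IH|r f g _ IHf _ IHg|r f a b _ IH].
- rewrite (_ : shift y _ = [ffun => c]); first exact: Deg_const.
  by apply/ffunP => x; rewrite !ffunE.
- exact: Deg_widen.
- by rewrite shiftD; apply: Deg_add.
- rewrite (_ : shift y _ =
    [ffun x => ((x *m a) ord0 ord0 + ((y *m a) ord0 ord0 + b)) * shift y f x]).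
    exact: Deg_mul.
  by apply/ffunP => x; rewrite !ffunE mulmxDl mxE addrA.
Qed.

(** Leibniz rule for an affine factor [l] with linear part [a]: the derivative of [l f] along [y] is
    [l] times that of [f], plus the constant [y *m a] times the shift of [f]. *)
Lemma deg_le_diff m r (y : point m) (f : fn m) : deg_le r f ->
  if r is r'.+1 then deg_le r' (diff y f) else diff y f = 0.
Proof.
elim=> {r f} [c|r f hf IH|r f g _ IHf _ IHg|r f a b hf IH].
- by apply/ffunP => x; rewrite !ffunE F2D.
- case: r hf IH => [|r] hf IH; last exact: Deg_widen.
  by rewrite IH; apply: deg_le0.
- have -> : diff y (f + g) = diff y f + diff y g.
    by rewrite /diff shiftD addrACA.
  by case: r IHf IHg => [-> ->|r]; [rewrite addr0 | exact: Deg_add].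
- pose c := (y *m a) ord0 ord0.
  have hcf : deg_le r [ffun x => c * shift y f x].
    have hs := deg_le_shift y hf.
    case: (F2P c) => ->; last first.
      by rewrite (_ : [ffun _ => _] = shift y f) //; apply/ffunP => x; rewrite ffunE mul1r.
    rewrite (_ : [ffun _ => _] = 0); first exact: deg_le0.
    by apply/ffunP => x; rewrite !ffunE mul0r.
  have -> : diff y [ffun x => ((x *m a) ord0 ord0 + b) * f x] =
     [ffun x => ((x *m a) ord0 ord0 + b) * diff y f x] + [ffun x => c * shift y f x].
    apply/ffunP => x; rewrite !ffunE mulmxDl mxE -/c.
    by rewrite addrAC mulrDl mulrDr addrAC.
  apply: Deg_add => //; case: r hf IH hcf => [|r] hf IH _; last exact: Deg_mul.
  rewrite IH (_ : [ffun _ => _] = 0); first exact: deg_le0.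
  by apply/ffunP => x; rewrite !ffunE mulr0.
Qed.

Lemma RM_diff m r (y : point m) (f : fn m) : f \in RM m r.+1 -> diff y f \in RM m r.
Proof. by move=> /deg_leP /(deg_le_diff y) /deg_leP. Qed.

Lemma RM_diff0 m (y : point m) (f : fn m) : f \in RM m 0 -> diff y f = 0.
Proof. by move=> /deg_leP /(deg_le_diff y). Qed.

Lemma RM_pullback m n r (A : 'M['F_2]_(m, n)) (f : fn n) : f \in RM n r ->
  [ffun x : point m => f (x *m A)] \in RM m r.
Proof.
move=> /deg_leP hf; apply/deg_leP.
elim: hf => {r f} [c|r f _ IH|r f g _ IHf _ IHg|r f a b _ IH].
- rewrite (_ : [ffun _ => _] = [ffun => c]); first exact: Deg_const.
  by apply/ffunP => x; rewrite !ffunE.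
- exact: Deg_widen.
- rewrite (_ : [ffun _ => _] = [ffun x : point m => f (x *m A)] + [ffun x => g (x *m A)]).
    exact: Deg_add.
  by apply/ffunP => x; rewrite !ffunE.
- rewrite (_ : [ffun _ => _] = [ffun x : point m =>
    ((x *m (A *m a)) ord0 ord0 + b) * [ffun x : point m => f (x *m A)] x]).
    exact: Deg_mul.
  by apply/ffunP => x; rewrite !ffunE mulmxA.
Qed.

Lemma RM_mul m r d (f g : fn m) : f \in RM m r -> g \in RM m d ->
  [ffun x => f x * g x] \in RM m (r + d).
Proof.
move=> /deg_leP hf /deg_leP hg; apply/deg_leP.
elim: hf => {r f} [c|r f _ IH|r f f' _ IHf _ IHf'|r f a b _ IH].
- have -> : [ffun x => [ffun => c] x * g x] = (if c == 0 then 0 else g) :> fn m.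
    apply/ffunP => x; rewrite !ffunE; case: (F2P c) => -> /=; rewrite ?mul1r //.
    by rewrite ffunE mul0r.
  by case: ifP => _ //; apply: deg_le0.
- by rewrite addSn; apply: Deg_widen.
- rewrite (_ : [ffun _ => _] = [ffun x => f x * g x] + [ffun x => f' x * g x]).
    exact: Deg_add.
  by apply/ffunP => x; rewrite !ffunE mulrDl.
- rewrite addSn (_ : [ffun _ => _] = [ffun x : point m =>
    ((x *m a) ord0 ord0 + b) * [ffun x => f x * g x] x]); first exact: Deg_mul.
  by apply/ffunP => x; rewrite !ffunE mulrA.
Qed.

(** A monomial of degree below [m] misses some variable [x_i]; translation by the unit vector [e]
    pairs points of equal value, which cancel in characteristic 2. *)
Lemma RM_sum_points m d (f : fn m) : (d < m)%N -> f \in RM m d -> \sum_x f x = 0.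
Proof.
move=> ltdm /RM_evalP[c ->].
under eq_bigr do rewrite RM_evalE; rewrite exchange_big big1 //= => S leSd.
have /subsetPn[i _ niS] : ~~ ([set: 'I_m] \subset S).
  by apply: contraTN leSd => /subset_leq_card; rewrite cardsT card_ord -ltnNge => /(leq_trans ltdm).
rewrite -mulr_sumr (bigID (fun x : point m => x ord0 i == 0)) /=.
pose e : point m := delta_mx ord0 i.
rewrite (reindex_inj (addIr e)) /=.
rewrite (eq_big (fun x : point m => x ord0 i != 0)
                (fun x : point m => \prod_(j in S) x ord0 j)).
- by rewrite F2D mulr0.
- move=> x; rewrite !mxE !eqxx; case: (F2P (x ord0 i)) => -> //=.
- move=> x _; apply: eq_bigr => j jS; rewrite !mxE eqxx.
  by rewrite (_ : j == i = false) ?addr0 //; apply: contraNF niS => /eqP <-.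
Qed.

Lemma RM_orthogonal m r d (f g : fn m) : (r + d < m)%N ->
  f \in RM m r -> g \in RM m d -> \sum_x f x * g x = 0.
Proof.
move=> ltm hf hg; rewrite -[RHS](RM_sum_points ltm (RM_mul hf hg)).
by apply: eq_bigr => x _; rewrite ffunE.
Qed.

(** Counting scheme of [card_RM_vanishing], [card_low_step] and [card_biased]: elements are encoded
    by some data, and only fibres through elements of [A] need a bound. *)
Lemma card_fiber_le (T U : finType) (A : {set T}) (B : {set U}) (h : T -> U) c :
  (forall a, a \in A -> h a \in B) ->
  (forall a, a \in A -> (#|[set a' in A | h a' == h a]| <= c)%N) ->
  (#|A| <= #|B| * c)%N.
Proof.
move=> hAB hc; rewrite -sum1_card (partition_big h (mem B)) //= -sum_nat_const.
apply: leq_sum => u _; rewrite sum1dep_card.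
have [a /andP[aA /eqP <-]|no] := pickP (fun a => (a \in A) && (h a == u)).
  exact: hc.
rewrite (_ : [set _ | _] = set0) ?cards0 //; apply/setP => a; rewrite !inE; exact: no.
Qed.

(** * Reduction to the weights of the orthogonal code *)

Definition wt m (f : fn m) : nat := #|[set x | f x != 0]|.

Definition vanishing m r (S : {set point m}) : {set fn m} :=
  [set f in RM m r | [forall x in S, f x == 0]].

Lemma card_translate_le m (A B : {set fn m}) (f : fn m) :
  (forall g, g \in A -> g + f \in B) -> (#|A| <= #|B|)%N.
Proof.
move=> hAB; rewrite -(card_imset (mem A) (addIr f)); apply: subset_leq_card.
by apply/subsetP => _ /imsetP[g gA ->]; apply: hAB.
Qed.

(** Restriction to [S] takes at most [2 ^ #|S|] values, and each of its fibres, translated by one of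
    its members, lies in [vanishing r S]. *)
Lemma card_RM_vanishing m r (S : {set point m}) :
  (#|RM m r| <= 2 ^ #|S| * #|vanishing r S|)%N.
Proof.
pose B : {set fn m} := [set g in pffun_on 0 (mem S) predT].
have cardB : #|B| = (2 ^ #|S|)%N.
  rewrite cardsE card_pffun_on; congr (_ ^ _)%N.
  by rewrite (_ : #|predT| = #|{: 'F_2}|) ?card_Fp //; apply: eq_card.
pose h (f : fn m) : fn m := [ffun x => if x \in S then f x else 0].
rewrite -cardB; apply: (@card_fiber_le _ _ _ _ h) => [f _|f fRM].
  rewrite inE; apply/pffun_onP; split => [|x //]; apply/supportP => x.
  by rewrite ffunE => /negPf ->.
apply: (@card_translate_le _ _ _ f) => g; rewrite !inE => /andP[gRM /eqP /ffunP eqh].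
rewrite RMD //=; apply/forall_inP => x xS; have := eqh x.
by rewrite !ffunE xS => ->; rewrite F2D.
Qed.

(** Some nonzero [w] in RM(m,d) is supported in [Z], and every [f] in RM(m,r) is orthogonal to it.
    If [f] vanishes on [Z] except perhaps at a point [z] with [w z != 0], then [f z = 0] follows;
    one condition on [Z] is redundant, which saves the factor 2. *)
Lemma card_RM_unrecoverable m r d (Z : {set point m}) : (r + d < m)%N ->
  ~~ erasure_recoverable d Z -> (2 * #|RM m r| <= 2 ^ #|Z| * #|vanishing r Z|)%N.
Proof.
move=> ltm; rewrite negb_forall_in => /exists_inP[w1 w1RM].
rewrite negb_forall_in => /exists_inP[w2 w2RM]; rewrite negb_imply => /andP[/forall_inP eqw neqw].
pose w := w1 + w2; have wRM : w \in RM m d by exact: RMD.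
have w0 x : x \notin Z -> w x = 0.
  by move=> xZ; rewrite ffunE (eqP (eqw x _)) ?inE // F2D.
have /existsP[z wz] : [exists z, w z != 0].
  apply: contraNT neqw; rewrite negb_exists => /forallP h.
  rewrite -subr_eq0 fnN; apply/eqP/ffunP => x.
  by have := h x; rewrite negbK => /eqP ->; rewrite ffunE.
have zZ : z \in Z by apply: contraNT wz => /w0 ->.
have -> : vanishing r Z = vanishing r (Z :\ z).
  apply/setP => f; rewrite !inE; apply: andb_id2l => fRM.
  apply/forall_inP/forall_inP => h x.
    by rewrite !inE => /andP[_ xZ]; apply: h.
  move=> xZ; have [->|nexz] := eqVneq x z; last by rewrite h // !inE nexz.
  have := RM_orthogonal ltm fRM wRM; rewrite (bigD1 z) //= big1 ?addr0.
    by move=> /eqP; rewrite mulf_eq0 (negPf wz) orbF.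
  move=> y neyz; have [yZ|yZ] := boolP (y \in Z); last by rewrite (w0 y) ?mulr0.
  by rewrite (eqP (h y _)) ?mul0r // !inE neyz.
rewrite (cardsD1 z Z) zZ expnS -mulnA leq_pmul2l //; exact: card_RM_vanishing.
Qed.

(** Sampling without replacement against sampling with replacement, factor by factor:
    [(z - i) / (n - i) <= z / n]. *)
Lemma bin_expn_le z n k : (z <= n)%N -> ('C(z, k) * n ^ k <= 'C(n, k) * z ^ k)%N.
Proof.
move=> lezn; rewrite -(leq_pmul2r (fact_gt0 k)) mulnAC bin_ffact [X in (_ <= X)%N]mulnAC bin_ffact.
elim: k => [|k IH] //; rewrite !ffactnSr !expnSr.
rewrite mulnACA [X in (_ <= X)%N]mulnACA leq_mul // mulnBl mulnBl.
by rewrite [(z * n)%N]mulnC leq_sub2l // leq_mul2l lezn orbT.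
Qed.

Lemma sum_card_vanishing m r K :
  (\sum_(Z : {set point m} | #|Z| == K) #|vanishing r Z| =
   \sum_(f in RM m r) 'C(2 ^ m - wt f, K))%N.
Proof.
transitivity (\sum_(Z : {set point m} | #|Z| == K) \sum_(f in RM m r)
   [forall x in Z, f x == 0%R] : nat)%N.
  apply: eq_bigr => Z _; rewrite -sum1_card [RHS]big_mkcond [LHS]big_mkcond /=.
  apply: eq_bigr => f _; rewrite inE; case: (f \in _) => //=.
rewrite exchange_big; apply: eq_bigr => f _ /=.
have -> : (2 ^ m - wt f = #|[set x | f x == 0%R]|)%N.
  rewrite -(card_point m) (cardsCs [set x | f x == 0%R]); congr (_ - _)%N.
  by apply: eq_card => x; rewrite !inE.
rewrite -cards_draws -sum1_card [RHS]big_mkcond [LHS]big_mkcond /=.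
apply: eq_bigr => Z _; rewrite inE andbC; case: (#|Z| == K) => //=.
have -> : (Z \subset [set x | f x == 0]) = [forall x in Z, f x == 0].
  by apply/subsetP/forall_inP => h x /h; rewrite inE.
by case: ([forall x in Z, f x == 0]).
Qed.

(** With [A] all sets of size [K] and [B] the unrecoverable ones, the two counting bounds summed
    over [A] bound [#|RM m r| (#|A| + #|B|)]. Dividing by [#|RM m r| #|A|] leaves the average of
    [(1 + beta_f) ^ K], as [1 + beta_f = 2 (1 - wt f / 2 ^ m)]. *)
Lemma unrecoverable_bound (R : realFieldType) m r d K : (r + d < m)%N -> (K <= 2 ^ m)%N ->
  1 - (#|[set Z : {set point m} | (#|Z| == K) && erasure_recoverable d Z]|)%:R
      / (#|[set Z : {set point m} | #|Z| == K]|)%:R <=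
  (\sum_(f in RM m r) (2 - 2 * (wt f)%:R / (2 ^+ m)) ^+ K) / #|RM m r|%:R - 1 :> R.
Proof.
move=> ltm leK.
set G := [set Z | _ && _]; set A := [set Z | _].
pose B := [set Z : {set point m} | (#|Z| == K) && ~~ erasure_recoverable d Z].
have cardA : #|A| = 'C(2 ^ m, K) by rewrite card_draws card_point.
have A0 : 0 < #|A|%:R :> R by rewrite ltr0n cardA bin_gt0.
have GB : #|A| = (#|G| + #|B|)%N.
  rewrite -(cardsID [set Z | erasure_recoverable d Z] A); congr (_ + _)%N;
  by apply: eq_card => Z; rewrite !inE // andbC.
have C0 : 0 < #|RM m r|%:R :> R by rewrite card_RM ltr0n expn_gt0.
have key : (#|RM m r| * (#|A| + #|B|) <= 2 ^ K * \sum_(f in RM m r) 'C(2 ^ m - wt f, K))%N.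
  rewrite -sum_card_vanishing big_distrr /=.
  have -> : (#|RM m r| * (#|A| + #|B|) = \sum_(Z : {set point m} | #|Z| == K)
      #|RM m r| * (1 + ~~ erasure_recoverable d Z))%N.
    rewrite -big_distrr big_split /= sum1dep_card; congr (_ * (_ + _))%N.
    rewrite -sum1dep_card big_mkcondr; apply: eq_bigr => Z _.
    by case: (erasure_recoverable d Z).
  apply: leq_sum => Z /eqP <-; have [rec|nrec] := boolP (erasure_recoverable d Z).
    by rewrite addn0 muln1 card_RM_vanishing.
  by rewrite mulnC (card_RM_unrecoverable ltm).
have {}key : #|RM m r|%:R * (#|A|%:R + #|B|%:R) <=
   #|A|%:R * \sum_(f in RM m r) (2 - 2 * (wt f)%:R / (2 ^+ m)) ^+ K :> R.
  rewrite -natrD -natrM; apply: le_trans (_ : _ <= (2 ^ K * \sum_(f in RM m r)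
     'C(2 ^ m - wt f, K))%:R) _; first by rewrite ler_nat.
  rewrite natrM natr_sum !mulr_sumr; apply: ler_sum => f _.
  have lewt : (wt f <= 2 ^ m)%N by rewrite -card_point max_card.
  have N0 : 0 < 2 ^+ m :> R by rewrite exprn_gt0.
  have -> : 2 - 2 * (wt f)%:R / 2 ^+ m = 2 * (2 ^ m - wt f)%:R / 2 ^+ m :> R.
    by rewrite natrB // natrX; field; rewrite gt_eqF.
  rewrite natrX (_ : #|A|%:R * _ = 2 ^+ K * (#|A|%:R * (2 ^ m - wt f)%:R ^+ K / (2 ^+ m) ^+ K)).
    rewrite ler_pM2l ?exprn_gt0 // ler_pdivlMr ?exprn_gt0 //.
    rewrite -!natrX -!natrM ler_nat cardA.
    exact/bin_expn_le/leq_subr.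
  by rewrite !exprMn exprVn; ring.
have GBR : #|G|%:R = #|A|%:R - #|B|%:R :> R by rewrite GB natrD addrK.
rewrite GBR mulrBl divff ?gt_eqF // opprB addrC subrK lerBrDl.
rewrite ler_pdivlMr // -(ler_pM2l A0); apply: le_trans key.
rewrite le_eqVlt; apply/orP; left; apply/eqP; field; rewrite gt_eqF //.
Qed.

(** * Words of low weight *)

Definition low m r k : {set fn m} := [set f in RM m r | (2 ^ k * wt f <= 2 ^ m)%N].

(** Nested pairs let derivatives and sums over directions peel off one direction at a time. *)
Fixpoint dirs m k : finType := if k is k'.+1 then (point m * dirs m k')%type else unit.

Lemma card_dirs m k : #|dirs m k| = ((2 ^ m) ^ k)%N.
Proof. by elim: k => [|k IH] /=; rewrite ?card_unit // card_prod IH card_point expnS. Qed.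

Fixpoint nderiv m k : dirs m k -> fn m -> fn m :=
  if k is k'.+1 then fun Y f => nderiv Y.2 (diff Y.1 f) else fun _ f => f.

Lemma RM_nderiv m r k (Y : dirs m k) (f : fn m) :
  f \in RM m (r + k) -> nderiv Y f \in RM m r.
Proof.
elim: k Y f => [|k IH] Y f /=; first by rewrite addn0.
by rewrite addnS => /(RM_diff Y.1); apply: IH.
Qed.

Lemma nderiv_eq0 m r (Y : dirs m r.+1) (f : fn m) : f \in RM m r -> nderiv Y f = 0.
Proof.
elim: r Y f => [|r IH] Y f fRM; first by rewrite /= RM_diff0.
exact: (IH Y.2 _ (RM_diff Y.1 fRM)).
Qed.

Lemma sum_dirsS m k (F : dirs m k.+1 -> nat) :
  (\sum_Y F Y = \sum_y \sum_(Y : dirs m k) F (y, Y))%N.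
Proof. by rewrite pair_big /=; apply: eq_bigr => -[y Y]. Qed.

Lemma card_set_sum (T : finType) (P : pred T) : #|[set x | P x]| = (\sum_x P x)%N.
Proof. by rewrite -sum1dep_card big_mkcond; apply: eq_bigr => x _; case: (P x). Qed.

Lemma wt_add m (f g : fn m) : (wt (f + g)%R <= wt f + wt g)%N.
Proof.
rewrite /wt; apply: leq_trans (leq_card_setU _ _); apply/subset_leq_card/subsetP => x.
by rewrite !inE ffunE; case: (F2P (f x)) => ->; rewrite ?add0r.
Qed.

Lemma wt_shift m y (f : fn m) : wt (shift y f) = wt f.
Proof.
rewrite /wt -(card_imset _ (addIr y)); apply: eq_card => x; rewrite !inE.
apply/imsetP/idP => [[z]|hx]; first by rewrite inE ffunE => hz ->.
by exists (x + y); rewrite ?inE ?ffunE -addrA pointD addr0.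
Qed.

Lemma wt_eq0 m (f : fn m) : wt f = 0%N -> f = 0.
Proof.
move=> /eqP; rewrite cards_eq0 => /eqP f0; apply/ffunP => x; rewrite ffunE.
by apply/eqP; have /setP/(_ x) := f0; rewrite !inE => /negbFE.
Qed.

Lemma leq_wt m (f : fn m) : (wt f <= 2 ^ m)%N.
Proof. by rewrite -card_point max_card. Qed.

(** Union bound over the [2 ^ k - 1] nonempty subsums of random directions: each is uniform, so it
    moves [x] into the support of [f] with probability [wt f / 2 ^ m]. In the induction a derivative
    has at most twice the weight, and [1 + 2 (2 ^ k - 1) = 2 ^ k.+1 - 1]. *)
Lemma card_neq_nderiv m k (f : fn m) x :
  (#|[set Y : dirs m k | nderiv Y f x != f x]| * 2 ^ m <=
   (2 ^ k - 1) * wt f * (2 ^ m) ^ k)%N.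
Proof.
elim: k f => [|k IH] f /=.
  by rewrite (_ : [set _ | _] = set0) ?cards0 //; apply/setP => Y; rewrite !inE eqxx.
have step : (#|[set Y : dirs m k.+1 | nderiv Y f x != f x]| <=
   wt f * (2 ^ m) ^ k + \sum_y #|[set Y : dirs m k | nderiv Y (diff y f) x != diff y f x]|)%N.
  rewrite card_set_sum sum_dirsS -(wt_shift x) /wt card_set_sum big_distrl -big_split /=.
  apply: leq_sum => y _; rewrite card_set_sum /= ffunE [y + x]addrC diffE.
  have [f0|f1] := eqVneq (f (x + y)) 0; first by rewrite add0n f0 add0r.
  apply: leq_trans (leq_addr _ _); rewrite mul1n -(card_dirs m k) -sum1_card.
  by apply: leq_sum => Y _; apply: leq_b1.
rewrite (leq_trans (leq_mul step (leqnn _))) // mulnDl big_distrl /=.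
apply: leq_trans (_ : _ <= wt f * (2 ^ m) ^ k * 2 ^ m +
   \sum_(y : point m) (2 ^ k - 1) * (2 * wt f) * (2 ^ m) ^ k)%N _.
  rewrite leq_add2l; apply: leq_sum => y _; apply: leq_trans (IH _) _.
  rewrite leq_mul2r leq_mul2l /diff; apply/orP; right; apply/orP; right.
  by rewrite (leq_trans (wt_add _ _)) // wt_shift mul2n addnn.
rewrite sum_nat_const card_point !expnS mul2n -addnn.
have := expn_gt0 2 k; nia.
Qed.

(** At such a weight the union bound is below 1, so at every point [f] agrees with some derivative
    of order [r.+1], which is zero. This ends the recursion on the weight. *)
Lemma low_eq0 m r (f : fn m) : f \in low m r r.+1 -> f = 0.
Proof.
rewrite inE => /andP[fRM lewt]; apply/ffunP => x.
have [/existsP[Y /eqP Yx]|] := boolP [exists Y : dirs m r.+1, nderiv Y f x == f x].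
  by rewrite -Yx nderiv_eq0.
rewrite negb_exists => /forallP noY.
have := card_neq_nderiv r.+1 f x.
rewrite (_ : [set _ | _] = setT) ?cardsT ?card_dirs; last first.
  by apply/setP => Y; rewrite !inE noY.
have [/wt_eq0 -> //|wt_gt0] := posnP (wt f).
have N_gt0 : (0 < (2 ^ m) ^ r.+1)%N by rewrite !expn_gt0.
rewrite mulnC leq_pmul2r // leqNgt (leq_trans _ lewt) //.
by rewrite ltn_pmul2r // subn1 prednK ?expn_gt0.
Qed.

(* A word [f] of weight at most [2^-k'] agrees with a derivative of order [k]
   in random directions outside an event of probability at most [2^(k-k')],
   pointwise; the product of two independent derivatives is wrong on a point
   where [f] vanishes only if both of them are. *)
Lemma low_approx m k k' (f : fn m) : (0 < k)%N -> (2 * k + 3 <= k')%N ->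
  (2 ^ k' * wt f <= 2 ^ m)%N ->
  exists Y : dirs m k * dirs m k,
    (2 ^ k'.+2 * wt ([ffun x => nderiv Y.1 f x * nderiv Y.2 f x] + f)%R <= 2 ^ m)%N.
Proof.
move=> k_gt0 lek lewt; pose N := (2 ^ m)%N; pose M := (N ^ k)%N.
pose p := (2 ^ k)%N; pose q := (2 ^ k')%N.
have N_gt0 : (0 < N)%N by rewrite expn_gt0.
have M_gt0 : (0 < M)%N by rewrite expn_gt0 N_gt0.
have lepq : (8 * (p * p) <= q)%N.
  by rewrite -expnD addnn -mul2n -[8%N]/(2 ^ 3)%N -expnD leq_pexp2l // addnC.
have p_gt1 : (1 < p)%N by rewrite /p -(prednK k_gt0) expnS leq_pmulr ?expn_gt0.
have cardM : #|dirs m k| = M by rewrite card_dirs.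
pose e (Y : dirs m k * dirs m k) := wt ([ffun x => nderiv Y.1 f x * nderiv Y.2 f x] + f).
have [/existsP[Y le]|] := boolP [exists Y, (2 ^ k'.+2 * e Y <= N)%N]; first by exists Y.
rewrite negb_exists => /forallP gtN; exfalso.
pose b x := (\sum_(Y : dirs m k) (nderiv Y f x != f x))%N.
have leb x : (q * b x <= p * M)%N.
  have := card_neq_nderiv k f x; rewrite card_set_sum -/(b x) -/N -/M -/p => hb.
  rewrite -(leq_pmul2r N_gt0) -mulnA (leq_trans (leq_mul (leqnn _) hb)) //.
  have {hb} h : (q * wt f * (p - 1) * M <= N * p * M)%N.
    by rewrite leq_mul // leq_mul // leq_subr.
  nia.
have sume : (\sum_Y e Y <= \sum_(x : point m) if f x == 0%R then b x * b x else b x * M + M * b x)%N.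
  rewrite /e /wt; under eq_bigr do rewrite card_set_sum; rewrite exchange_big /=.
  apply: leq_sum => x _.
  rewrite -(pair_bigA _ (fun Y Y' =>
    ([ffun x => nderiv Y f x * nderiv Y' f x] + f)%R x != 0%R : nat)) /=.
  have [f0|f1] := eqVneq (f x) 0; rewrite /b.
    rewrite big_distrlr /=; apply: leq_sum => Y _; apply: leq_sum => Y' _.
    by rewrite !ffunE f0 addr0 mulf_eq0 negb_or mulnb.
  rewrite -cardM -!sum1_card !big_distrlr -big_split /=; apply: leq_sum => Y _.
  rewrite -big_split /=; apply: leq_sum => Y' _; rewrite muln1 mul1n !ffunE.
  move: f1; rewrite F2_neq0 => /eqP ->.
  by case: (F2P (nderiv Y f x)) => ->; case: (F2P (nderiv Y' f x)) => ->.
(* The average of [e] is at most [(p / q) ^ 2 N + 2 (p / q) wt f], hence at most [2 (p / q) ^ 2 N]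
   since [q * wt f <= N] and [2 <= p]. As [8 p ^ 2 <= q], this is at most [N / (4 q)], against
   [gtN]. *)
have lesum : (q * q * \sum_Y e Y <= N * M * M * (2 * p * p))%N.
  apply: leq_trans (_ : _ <= \sum_(x : point m)
     (p * p * M * M + (f x != 0%R) * (2 * q * p * M * M)))%N _.
    rewrite (leq_trans (leq_mul (leqnn _) sume)) // big_distrr /=.
    apply: leq_sum => x _; have h := leb x; have hh := leq_mul h h.
    have [_|_] := eqVneq (f x) 0; first by rewrite mul0n; lia.
    have := leq_mul (leqnn (2 * q * M)) h; nia.
  rewrite big_split /= sum_nat_const card_point -big_distrl /= -card_set_sum.
  have h1 : (q * wt f * (2 * p * M * M) <= N * (2 * p * M * M))%N by rewrite leq_mul2r lewt orbT.
  have h2 : (p * 2 * (N * M * M) <= p * p * (N * M * M))%N by rewrite leq_mul2r leq_mul2l p_gt1 !orbT.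
  rewrite -/(wt f) -/N; lia.
have gtsum : (N.+1 * (M * M) <= 4 * q * \sum_Y e Y)%N.
  rewrite mulnC -cardM -card_prod -sum_nat_const big_distrr /=; apply: leq_sum => Y _.
  by have := gtN Y; rewrite -ltnNge !expnS; lia.
have h1 : (8 * (p * p) * (q * \sum_Y e Y) <= q * (q * \sum_Y e Y))%N by rewrite leq_mul2r lepq orbT.
have h2 : (2 * p * p * (N.+1 * (M * M)) <= 2 * p * p * (4 * q * \sum_Y e Y))%N by rewrite leq_mul2l gtsum orbT.
have h3 : (0 < p * p * (M * M))%N by rewrite !muln_gt0 M_gt0 (ltnW p_gt1).
lia.
Qed.

(** A word is encoded by its directions and its two derivatives, of degree [r - k]. Words with the
    same code share the product [u], so their sum has relative weight at most twice [2^-(k'+2)]. *)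
Lemma card_low_step m r k k' : (0 < k <= r)%N -> (2 * k + 3 <= k')%N ->
  (#|low m r k'| <= (2 ^ m) ^ (2 * k) * #|RM m (r - k)| ^ 2 * #|low m r k'.+1|)%N.
Proof.
move=> /andP[k_gt0 lekr] lek.
(* The implication makes the choice of [Y] total; outside [low m r k'] any directions will do. *)
have hY (f : fn m) : exists Y : dirs m k * dirs m k, (f \in low m r k') ==>
    (2 ^ k'.+2 * wt ([ffun x => nderiv Y.1 f x * nderiv Y.2 f x] + f)%R <= 2 ^ m)%N.
  have [fl|_] := boolP (f \in low m r k'); last first.
    have /card_gt0P[Y _] : (0 < #|{: dirs m k * dirs m k}|)%N.
      by rewrite card_prod card_dirs muln_gt0 !expn_gt0.
    by exists Y.
  by move: fl; rewrite inE => /andP[_ /(low_approx k_gt0 lek)].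
pose Y f := xchoose (hY f).
have YP f : f \in low m r k' ->
    (2 ^ k'.+2 * wt ([ffun x => nderiv (Y f).1 f x * nderiv (Y f).2 f x] + f)%R <= 2 ^ m)%N.
  by apply/implyP/(xchooseP (hY f)).
pose h f := (Y f, (nderiv (Y f).1 f, nderiv (Y f).2 f)).
pose B := setX [set: dirs m k * dirs m k] (setX (RM m (r - k)) (RM m (r - k))).
have <- : #|B| = ((2 ^ m) ^ (2 * k) * #|RM m (r - k)| ^ 2)%N.
  by rewrite !cardsX cardsT card_prod card_dirs mulnC -!expnD addnn -mul2n expnM mulnn mulnC.
apply: (@card_fiber_le _ _ _ _ h) => f fl.
  move: (fl); rewrite inE => /andP[fRM _].
  by rewrite !inE /= !RM_nderiv // subnK.
apply: (@card_translate_le _ _ _ f) => g; rewrite inE => /andP[gl /eqP[eY e1 e2]].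
have := YP g gl; have := YP f fl.
rewrite -eY in e1 e2 *; rewrite e1 e2; set u := [ffun x => _] => hf hg.
move: (fl) (gl); rewrite !inE => /andP[fRM _] /andP[gRM _]; rewrite RMD //=.
have -> : g + f = (u + g) + (u + f) by rewrite addrACA fnD add0r.
have := leq_mul (leqnn (2 ^ k')) (wt_add (u + g) (u + f)); rewrite !expnS in hf hg *.
move: (wt _) (wt _) (wt _) (2 ^ k')%N (2 ^ m)%N hf hg => a b c P N; lia.
Qed.

(** * Words of large bias *)

(** This is [1 - 2 wt f / 2 ^ m >= 2^-l], cleared of denominators and subtraction. *)
Definition biased m r l : {set fn m} :=
  [set f in RM m r | (2 ^ m + 2 ^ l.+1 * wt f <= 2 ^ (l + m))%N].

Definition sgn m (f : fn m) (x : point m) : rat := if f x == 0 then 1 else -1.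

Lemma sgn_add m (f g : fn m) x : sgn (f + g) x = sgn f x * sgn g x.
Proof. by rewrite /sgn ffunE; case: (F2P (f x)) => ->; case: (F2P (g x)) => ->. Qed.

Lemma sum_sgn m (f : fn m) : \sum_x sgn f x = 2 ^+ m - 2 * (wt f)%:R.
Proof.
rewrite /wt card_set_sum natr_sum mulr_sumr -natrX -card_point -sum1_card natr_sum -sumrB.
by apply: eq_bigr => x _; rewrite /sgn; case: eqP.
Qed.

(* [spread Y G x] is the sum of [G] over the coset of [x] modulo the span of
   the directions [Y], counted with multiplicity. *)
Fixpoint spread m k : dirs m k -> (point m -> rat) -> point m -> rat :=
  if k is k'.+1 then fun Y G => spread Y.2 (fun x => G x + G (x + Y.1))
  else fun _ G => G.

Lemma eq_spread m k (Y : dirs m k) G H : G =1 H -> spread Y G =1 spread Y H.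
Proof. by elim: k Y G H => [|k IH] Y G H eqGH //=; apply: IH => x; rewrite !eqGH. Qed.

Lemma spread_subc m k (Y : dirs m k) G c x :
  spread Y (fun z => G z - c) x = spread Y G x - 2 ^+ k * c.
Proof.
elim: k Y G c => [|k IH] Y G c /=; first by rewrite mul1r.
rewrite (@eq_spread _ _ _ _ (fun z => (G z + G (z + Y.1)) - (2 * c))); last by move=> z; ring.
by rewrite IH exprS; ring.
Qed.

Lemma sum_point_shift m (y : point m) (G : point m -> rat) :
  \sum_x G (x + y) = \sum_x G x.
Proof. by rewrite [RHS](reindex_inj (addIr y)). Qed.

(* The points of a random coset are pairwise independent, so the variances of
   a mean-zero [G] add up. *)
Lemma sum_spread_sqr m k (G : point m -> rat) : \sum_x G x = 0 ->
  \sum_(Y : dirs m k) \sum_x spread Y G x ^+ 2 =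
  (2 ^+ m) ^+ k * 2 ^+ k * \sum_x G x ^+ 2.
Proof.
elim: k G => [|k IH] G G0 /=.
  by rewrite (eq_bigr (fun=> \sum_x G x ^+ 2)) // sumr_const card_unit !mul1r.
rewrite -(pair_bigA _ (fun y (Y : dirs m k) =>
   \sum_x spread Y (fun z => G z + G (z + y)) x ^+ 2)) /=.
rewrite (eq_bigr (fun y => (2 ^+ m) ^+ k * 2 ^+ k *
   (2 * \sum_x G x ^+ 2 + 2 * \sum_x G x * G (x + y)))) => [|y _]; last first.
  rewrite IH; last by rewrite big_split /= sum_point_shift G0 addr0.
  congr (_ * _); rewrite (eq_bigr (fun x => G x ^+ 2 + G (x + y) ^+ 2 + 2 * (G x * G (x + y)))).
    rewrite !big_split /= (sum_point_shift y (fun x => G x ^+ 2)) -mulr_sumr; ring.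
  by move=> x _; ring.
have cross : \sum_y \sum_x G x * G (x + y) = 0.
  rewrite exchange_big big1 //= => x _; rewrite -mulr_sumr.
  rewrite (eq_bigr (fun y => G (y + x))) ?sum_point_shift ?G0 ?mulr0 // => y _.
  by rewrite addrC.
rewrite -mulr_sumr big_split /= -[X in _ + X]mulr_sumr cross.
rewrite sumr_const card_point -(mulr_natl _ (2 ^ m)) natrX !exprS; ring.
Qed.

(** Chebyshev: [sgn f] has mean [S / N >= 2^-l], and its sum over a random coset of [2 ^ t] points
    has variance at most [2 ^ t]. A nonpositive sum deviates by at least [2 ^ t S / N], so it occurs
    with probability at most [2^(2l-t) = 2^-q]; some [Y] does as well as the average. *)
Lemma biased_approx m r l q (f : fn m) : f \in biased m r l ->
  exists Y : dirs m (2 * l + q),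
    (2 ^ q * #|[set x | (spread Y (sgn f) x <= 0)%R]| <= 2 ^ m)%N.
Proof.
set t := (2 * l + q)%N; rewrite inE => /andP[_ lewt].
pose N : rat := 2 ^+ m; have N0 : 0 < N by rewrite exprn_gt0.
pose S := \sum_x sgn f x.
have leS : N <= 2 ^+ l * S.
  rewrite /S sum_sgn (_ : 2 ^+ l * _ = (2 ^ (l + m))%:R - (2 ^ l.+1 * wt f)%:R).
    by rewrite lerBrDr /N -natrX -natrD ler_nat.
  by rewrite natrM !natrX exprD exprS; ring.
have S0 : 0 < S by rewrite -(pmulr_rgt0 _ (exprn_gt0 l (ltr0Sn rat 1))) (lt_le_trans N0).
pose G x := sgn f x - S / N.
have G0 : \sum_x G x = 0.
  rewrite sumrB sumr_const card_point -mulr_natl natrX -/N mulrC divfK ?gt_eqF //.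
  exact: subrr.
have GN : \sum_x G x ^+ 2 <= N.
  have -> : \sum_x G x ^+ 2 = N - S ^+ 2 / N; last by rewrite gerBl divr_ge0 ?sqr_ge0 ?ltW.
  rewrite (eq_bigr (fun x => 1 + (S / N) ^+ 2 - 2 * (S / N) * sgn f x)).
    rewrite sumrB sumr_const -mulr_sumr -/S card_point -(mulr_natl _ (2 ^ m)) natrX -/N.
    by field; rewrite gt_eqF.
  by move=> x _; rewrite /G /sgn; case: eqP => _; ring.
pose b (Y : dirs m t) := #|[set x | spread Y (sgn f) x <= 0]|.
have leb (Y : dirs m t) : (b Y)%:R * (2 ^+ t * (S / N)) ^+ 2 <= \sum_x spread Y G x ^+ 2.
  rewrite /b card_set_sum natr_sum mulr_suml; apply: ler_sum => x _.
  have [le0|_] := boolP (_ <= 0); last by rewrite mul0r sqr_ge0.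
  rewrite mul1r spread_subc -[leRHS]sqrrN opprB lerXn2r ?nnegrE //.
  - by rewrite mulr_ge0 ?exprn_ge0 // ltW // divr_gt0.
  - by rewrite subr_ge0 (le_trans le0) // mulr_ge0 ?exprn_ge0 // ltW // divr_gt0.
  - by rewrite lerBrDr gerDl.
have sumb : (\sum_Y b Y)%:R * 2 ^+ q <= N ^+ t * N.
  have : (\sum_Y b Y)%:R * (2 ^+ t * (S / N)) ^+ 2 <= N ^+ t * 2 ^+ t * N.
    rewrite natr_sum mulr_suml (le_trans (ler_sum _ (fun Y _ => leb Y))) //.
    rewrite (sum_spread_sqr _ G0) ler_wpM2l // mulr_ge0 ?exprn_ge0 // ltW //.
  have h : 1 <= 2 ^+ l * (S / N) by rewrite mulrA ler_pdivlMr // mul1r.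
  have h2 : 1 <= (2 ^+ l * (S / N)) ^+ 2 by rewrite exprn_ege1.
  have -> : (2 ^+ t * (S / N)) ^+ 2 = (2 ^+ l * (S / N)) ^+ 2 * 2 ^+ q * 2 ^+ t.
    by rewrite !exprMn /t mul2n -addnn !exprD; ring.
  rewrite [X in _ <= X]mulrAC => hb; rewrite -(ler_pM2r (exprn_gt0 t (ltr0Sn rat 1))).
  apply: le_trans hb; move: (_ ^+ 2) h2 => c c_ge1.
  by rewrite -!mulrA ler_wpM2l ?ler0n // ler_peMl // mulr_ge0 ?exprn_ge0.
have [/existsP[Y]|] := boolP [exists Y, (2 ^ q * b Y <= 2 ^ m)%N]; first by exists Y.
rewrite negb_exists => /forallP gtN; exfalso.
have gtsum : (((2 ^ m) ^ t) * (2 ^ m).+1 <= (\sum_Y b Y) * 2 ^ q)%N.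
  rewrite -card_dirs -sum_nat_const big_distrl /=; apply: leq_sum => Y _.
  by rewrite mulnC ltnNge gtN.
move: sumb; rewrite /N -!natrX -!natrM ler_nat leqNgt (leq_trans _ gtsum) //.
by rewrite ltn_pmul2l ?expn_gt0.
Qed.

Fixpoint invariant_by m k : dirs m k -> fn m -> bool :=
  if k is k'.+1 then fun Y h => (shift Y.1 h == h) && invariant_by Y.2 h
  else fun _ _ => true.

Lemma invariant_by_add m k (Y : dirs m k) (g h : fn m) :
  invariant_by Y g -> invariant_by Y h -> invariant_by Y (g + h).
Proof.
elim: k Y => [|k IH] Y //= /andP[/eqP g1 g2] /andP[/eqP h1 h2].
by rewrite shiftD g1 h1 eqxx IH.
Qed.

Lemma spread_invariant m k (Y : dirs m k) (h : fn m) G x : invariant_by Y h ->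
  spread Y (fun z => sgn h z * G z) x = sgn h x * spread Y G x.
Proof.
elim: k Y G => [|k IH] Y G //= /andP[/eqP h1 h2].
rewrite -IH //; apply: eq_spread => z; rewrite mulrDr; congr (_ + _ * _).
by rewrite /sgn -{2}h1 ffunE.
Qed.

Fixpoint dirs_mx m k : dirs m k -> 'M['F_2]_(k, m) :=
  if k is k'.+1 then fun Y => col_mx Y.1 (dirs_mx Y.2) : 'M_(1 + k', m) else fun _ => 0.

Lemma invariant_pullback m n k (Y : dirs m k) (A : 'M['F_2]_(m, n)) (g : fn n) :
  dirs_mx Y *m A = 0 -> invariant_by Y [ffun x => g (x *m A)].
Proof.
elim: k Y => [|k IH] Y //= YA.
have /eqP := etrans (esym (mul_col_mx Y.1 (dirs_mx Y.2) A)) YA.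
rewrite col_mx_eq0 => /andP[/eqP A1 /eqP A2]; rewrite IH // andbT.
by apply/eqP/ffunP => x; rewrite !ffunE mulmxDl A1 addr0.
Qed.

Lemma leq_binom_le m n r : (m <= n)%N -> (binom_le m r <= binom_le n r)%N.
Proof. by move=> lemn; apply: leq_sum => j _; apply: leq_bin2l. Qed.

(** The map [x *m A] is the quotient by the span of [Y]. It is onto because [row_base K] has a right
    inverse, so words on the quotient pull back injectively to invariant words. *)
Lemma card_invariant m r k (Y : dirs m k) :
  (2 ^ binom_le (m - k) r <= #|[set h in RM m r | invariant_by Y h]|)%N.
Proof.
pose K := kermx (dirs_mx Y)^T; pose A := (row_base K)^T.
have rankA : (m - k <= \rank K)%N.
  by rewrite mxrank_ker leq_sub2l // mxrank_tr rank_leq_row.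
have YA : dirs_mx Y *m A = 0.
  apply: trmx_inj; rewrite trmx_mul trmxK trmx0; apply/sub_kermxP.
  by rewrite eq_row_base.
have [B AB] : exists B, row_base K *m B = 1%:M by apply/row_freeP/row_base_free.
apply: (leq_trans (n := #|RM (\rank K) r|)).
  by rewrite card_RM leq_exp2l // leq_binom_le.
have inj : injective (fun g : fn (\rank K) => [ffun x : point m => g (x *m A)]).
  move=> g g' /ffunP eqg; apply/ffunP => z; have := eqg (z *m B^T).
  by rewrite !ffunE -mulmxA -trmx_mul AB trmx1 mulmx1.
rewrite -(card_imset _ inj); apply/subset_leq_card/subsetP => _ /imsetP[g gRM ->].
by rewrite inE RM_pullback //= invariant_pullback.
Qed.

(** Pairs [(f, h)] with [h] invariant under [Y f] are encoded by [(Y f, f + h)]. If [(g, k)] has the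
    same code, [f + g] is invariant, so the coset sums of [sgn f] and [sgn g] agree up to sign;
    where [f + g] is nonzero they are opposite, hence one is nonpositive. Two exceptional sets of
    density [2^-(q+1)] thus cover the support of [f + g]. *)
Lemma card_biased m r l q :
  (#|biased m r l| * 2 ^ binom_le (m - (2 * l + q.+1)) r <=
   (2 ^ m) ^ (2 * l + q.+1) * 2 ^ binom_le m r * #|low m r q|)%N.
Proof.
set t := (2 * l + q.+1)%N.
have hY (f : fn m) : exists Y : dirs m t, (f \in biased m r l) ==>
    (2 ^ q.+1 * #|[set x | (spread Y (sgn f) x <= 0)%R]| <= 2 ^ m)%N.
  have [fl|_] := boolP (f \in biased m r l); last first.
    have /card_gt0P[Y _] : (0 < #|{: dirs m t}|)%N by rewrite card_dirs !expn_gt0.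
    by exists Y.
  exact: biased_approx fl.
pose Y f := xchoose (hY f).
have YP f : f \in biased m r l -> 
    (2 ^ q.+1 * #|[set x | (spread (Y f) (sgn f) x <= 0)%R]| <= 2 ^ m)%N.
  by apply/implyP/(xchooseP (hY f)).
pose T := [set fh : fn m * fn m | (fh.1 \in biased m r l) &&
   (fh.2 \in [set h in RM m r | invariant_by (Y fh.1) h])].
apply: (leq_trans (n := #|T|)).
  have -> : #|T| = (\sum_(f : fn m) \sum_(h : fn m) ((f \in biased m r l) &&
    (h \in [set h in RM m r | invariant_by (Y f) h])))%N.
    by rewrite /T card_set_sum pair_bigA.
  rewrite -sum_nat_const big_mkcond; apply: leq_sum => f _ /=.
  case: ifP => // _; apply: leq_trans (card_invariant r (Y f)) _.
  by rewrite card_set_sum; apply: leq_sum => h _; rewrite inE.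
have <- : #|setX [set: dirs m t] (RM m r)| = ((2 ^ m) ^ t * 2 ^ binom_le m r)%N.
  by rewrite cardsX cardsT card_dirs card_RM.
apply: (@card_fiber_le _ _ _ _ (fun fh : fn m * fn m => (Y fh.1, fh.1 + fh.2))).
  move=> [f h]; rewrite !inE /= => /andP[/andP[fRM _] /andP[hRM _]].
  by rewrite RMD.
move=> [f h]; rewrite !inE /= => /andP[fb /andP[hRM hinv]].
have fb' : f \in biased m r l by rewrite inE.
set F := [set _ in T | _].
(* In a fibre the second component is determined by the first, so counting first components,
   translated by [f], is enough. *)
have FE (fh : fn m * fn m) : fh \in F -> fh.2 = fh.1 + (f + h).
  rewrite inE => /andP[_ /eqP[_ <-]]; rewrite addrA fnD add0r //.
rewrite -(@card_in_imset _ _ (fun fh : fn m * fn m => fh.1 + f) F); last first.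
  by move=> [f1 h1] [f2 h2] /FE /= -> /FE /= -> /addIr ->.
apply/subset_leq_card/subsetP => _ /imsetP[[g k] gkF ->] /=.
have := gkF; rewrite !inE /= => /andP[/andP[gb /andP[kRM kinv]] /eqP[eqY eqgk]].
have gb' : g \in biased m r l by rewrite inE.
rewrite RMD //=; [|by case/andP: gb|by case/andP: fb].
have gfE : g + f = h + k.
  by have /= -> := FE _ gkF; rewrite addrCA [h + _]addrCA fnD addr0.
have inv : invariant_by (Y f) (g + f).
  by rewrite gfE invariant_by_add // -eqY.
have := YP _ gb'; have := YP _ fb'; rewrite eqY.
set a := #|_|; set b := #|_| => ha hb.
have le : (wt (g + f)%R <= b + a)%N.
  apply: leq_trans (leq_card_setU _ _); apply/subset_leq_card/subsetP => x.
  rewrite !inE => gf1.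
  have -> : spread (Y f) (sgn g) x = - spread (Y f) (sgn f) x.
    rewrite (@eq_spread _ _ _ _ (fun z => sgn (g + f) z * sgn f z)).
      by rewrite spread_invariant // [sgn (g + f) x]/sgn (negPf gf1) mulN1r.
    by move=> z; rewrite -sgn_add -addrA fnD addr0.
  by rewrite oppr_le0 le_total.
have := leq_mul (leqnn (2 ^ q)) le; rewrite !expnS in ha hb *.
move: (wt _) (2 ^ q)%N (2 ^ m)%N a b ha hb {le} => w Q N a b; lia.
Qed.

(** * Partial sums of binomial coefficients *)

Lemma binom_leSS n r : binom_le n.+1 r.+1 = (binom_le n r.+1 + binom_le n r)%N.
Proof.
rewrite /binom_le big_ord_recl [in RHS]big_ord_recl /= !bin0 -addnA -big_split /=.
by congr (_ + _)%N; apply: eq_bigr => i _; rewrite binS.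
Qed.

Lemma leq_bin_binom_le n r k : (k <= r)%N -> ('C(n, k) <= binom_le n r)%N.
Proof.
move=> lekr; rewrite /binom_le.
by rewrite (bigD1 (Ordinal (lekr : (k < r.+1)%N))) //= leq_addr.
Qed.

(** Termwise: ['C(n, i.+1) / 'C(n, i) = (n - i) / i.+1 >= g] for [i <= r]. *)
Lemma binom_le_ratio g n r : (g * r.+1 + r <= n)%N ->
  (g * binom_le n r <= binom_le n r.+1)%N.
Proof.
move=> len; rewrite /binom_le [leqRHS]big_ord_recl big_distrr /=.
apply: leq_trans (leq_addl _ _); apply: leq_sum => i _; rewrite /bump /= add1n.
rewrite -(leq_pmul2l (ltn0Sn i)) mul_bin_left mulnA leq_mul2r mulnC; apply/orP; right.
have : (g * i.+1 <= g * r.+1)%N by rewrite leq_mul2l ltn_ord orbT.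
have := ltn_ord i; lia.
Qed.

Lemma binom_le_ratioX g n r k : (g * r + r <= n)%N -> (k <= r)%N ->
  (g ^ k * binom_le n (r - k) <= binom_le n r)%N.
Proof.
move=> len; elim: k => [|k IH] lek; first by rewrite mul1n subn0.
apply: leq_trans (IH (ltnW lek)); rewrite expnSr -mulnA leq_mul //.
rewrite -(subnSK lek) binom_le_ratio //.
have : (g * (r - k.+1).+1 <= g * r)%N by rewrite leq_mul2l; lia.
lia.
Qed.

(** By Pascal's rule, each variable removed costs a sum of order one lower, which is at most a
    fraction [1 / g] of the whole. *)
Lemma binom_le_loss g n r s : (g * r + r <= n)%N ->
  (g * binom_le (n + s) r <= g * binom_le n r + s * binom_le (n + s) r)%N.
Proof.
case: r => [|r] len; first by rewrite /binom_le !big_ord1 !bin0; lia.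
elim: s => [|s IH]; first by rewrite addn0 leq_addr.
have := @binom_le_ratio g (n + s) r; rewrite addnS binom_leSS.
move: (binom_le (n + s) r.+1) (binom_le (n + s) r) (binom_le n r.+1) IH => a b c IH h.
have {}h : (g * b <= a)%N by apply: h; nia.
nia.
Qed.

Lemma binom_le_half g n r : (g * r + r <= n)%N -> (6 <= g)%N ->
  (binom_le n.+3 r <= 2 * binom_le n r)%N.
Proof.
move=> len leg; have := binom_le_loss 3 len; rewrite addn3.
move: (binom_le _ _) (binom_le _ _) => a b; nia.
Qed.

(** The first 13 variables cost at most [13 / g <= 1 / 4] of the sum, and each further block of
    three at most halves it. The number [3 l + 4] is the dimension in [card_biased] for
    [q = l + 3]. *)
Lemma binom_le_drop g m r l : (52 <= g)%N -> (3 <= l)%N -> (g * r + r + 3 * l + 4 <= m)%N ->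
  (3 * binom_le m r <= 4 * 2 ^ (l - 3) * binom_le (m - (3 * l + 4)) r)%N.
Proof.
move=> leg; elim: l => [|l IH] // lel lem.
have [ltl|lel2] := ltnP 2 l; last first.
  have {IH lel lel2} el : l = 2%N by lia.
  subst l; rewrite subnn expn0 muln1; change (3 * 3 + 4)%N with 13%N.
  have := @binom_le_loss g (m - 13) r 13; rewrite subnK; last by lia.
  move: (binom_le _ _) (binom_le _ _) => a b; nia.
have /(_ ltl) := IH; rewrite subSn // expnS => /(_ ltac:(lia)) h.
have := @binom_le_half g (m - (3 * l.+1 + 4)) r.
rewrite (_ : (m - (3 * l.+1 + 4)).+3 = m - (3 * l + 4))%N; last by lia.
move=> /(_ ltac:(lia) ltac:(lia)) h2.
have := leq_mul (leqnn (4 * 2 ^ (l - 3))) h2; lia.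
Qed.

Lemma binom_le_max n r : (binom_le n r <= 2 ^ n)%N.
Proof.
rewrite -(card_subsets_le n r) -[n in (2 ^ n)%N]card_ord -cardsT -card_powerset.
by apply/subset_leq_card/subsetP => S _; rewrite powersetE subsetT.
Qed.

(** Adding 80 variables at most doubles the sum, since [80 / g <= 1 / 2]. *)
Lemma binom_le_exp g n r j : (160 <= g)%N -> (g * r + r <= n)%N ->
  (binom_le (n + 80 * j) r <= 2 ^ (n + j))%N.
Proof.
move=> leg len; elim: j => [|j IH]; first by rewrite muln0 !addn0 binom_le_max.
have := @binom_le_loss g (n + 80 * j) r 80; rewrite -addnA -mulnSr addnS expnS => h.
have {}h := h ltac:(lia); move: (binom_le _ _) (binom_le _ _) (2 ^ _)%N h IH => a b c; nia.
Qed.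

Lemma binom_le_small m r : (2 ^ 14 * r <= m)%N -> (binom_le m r <= 2 ^ (m %/ 40 + 81))%N.
Proof.
move=> ler; pose j := ((m - 161 * r) %/ 80)%N; pose n := (m - 80 * j)%N.
have mE : m = (n + 80 * j)%N by rewrite /n; lia.
have := @binom_le_exp 160 n r j isT; rewrite -mE => h.
apply: leq_trans (h _) _; first by rewrite /n; lia.
by rewrite leq_exp2l // /n; lia.
Qed.

Lemma binom_le_large1 g n r : (1 < r)%N -> (g * r + r <= n)%N -> (g ^ r.-1 * n <= binom_le n r)%N.
Proof.
move=> r1 len; have := @binom_le_ratioX g n r r.-1 len (leq_pred _).
apply: leq_trans; rewrite leq_mul2l; apply/orP; right.
rewrite (_ : r - r.-1 = 1)%N; last by lia.
by rewrite -[n in (n <= _)%N]bin1 leq_bin_binom_le.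
Qed.

Lemma binom_le_large2 g n r : (2 < r)%N -> (g * r + r <= n)%N ->
  (g * (n * n.-1) <= 2 * binom_le n r)%N.
Proof.
move=> r2 len; have := @binom_le_ratioX g n r (r - 2) len (leq_subr _ _).
rewrite subKn; last by lia.
have h := leq_bin_binom_le n (leqnn 2); have e := mul_bin_diag n 1.
rewrite bin1 in e.
have lg : (g <= g ^ (r - 2))%N.
  case: (posnP g) => [-> //|g0]; rewrite -[X in (X <= _)%N]expn1 leq_pexp2l //; lia.
have := leq_mul lg (leqnn 'C(n, 2)); have := leq_mul (leqnn (g ^ (r - 2))) h.
nia.
Qed.

(** * Summation over the weights *)

Lemma subset_low m r k k' : (k <= k')%N -> low m r k' \subset low m r k.
Proof.
move=> lek; apply/subsetP => f; rewrite !inE => /andP[-> lewt] /=.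
by apply: leq_trans lewt; rewrite leq_mul2r leq_exp2l // lek orbT.
Qed.

Lemma card_low_gt m r k : (r < k)%N -> (#|low m r k| <= 1)%N.
Proof.
move=> ltrk; rewrite -[leqRHS](cards1 (0 : fn m)); apply/subset_leq_card/subsetP => f.
by move=> /(subsetP (subset_low _ _ ltrk)) /low_eq0 ->; rewrite inE.
Qed.

(** In logarithms, [log2 #|low m r k| <= D / 2^(k+4)]. The induction descends from [k = r.+1], where
    only 0 is left; one recursion step costs at most [D / 2^(k+5)], and so does the next level. *)
Lemma card_low_exp m r k : (1 < r)%N -> (2 ^ 24 * r <= m)%N -> (4 < k)%N ->
  (#|low m r k| ^ 2 ^ (k + 4) <= 2 ^ binom_le m r)%N.
Proof.
move=> r_gt1 lerm; move: {2}(r.+1 - k)%N (erefl (r.+1 - k)%N) => n.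
elim: n k => [|n IH] k en k_gt4.
  apply: (@leq_trans (1 ^ 2 ^ (k + 4))); last by rewrite exp1n expn_gt0.
  by rewrite leq_exp2r ?expn_gt0 //; apply: card_low_gt; lia.
have {}IH := IH k.+1 ltac:(lia) ltac:(lia).
pose j := ((k - 3) %/ 2)%N.
have lejr : (0 < j <= r)%N by rewrite /j; lia.
have lejk : (2 * j + 3 <= k)%N by rewrite /j; lia.
have step := card_low_step m lejr lejk; rewrite card_RM -!expnM -expnD in step.
have len : (2 ^ 13 * r + r <= m)%N by lia.
have ratio := binom_le_ratioX len (proj2 (andP lejr)).
have large := binom_le_large1 r_gt1 len.
have expo : ((m * (2 * j) + binom_le m (r - j) * 2) * 2 ^ (k + 5) <= binom_le m r)%N.
  (* Each drop in degree gains a factor [2 ^ 13], and [k + 7 <= 13 j], with equality at [k = 6]. *)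
  have h1 : (2 ^ (k + 7) * binom_le m (r - j) <= binom_le m r)%N.
    by apply: leq_trans ratio; rewrite leq_mul2r -expnM leq_exp2l // /j; lia.
  have h2 : (r * 2 ^ (k + 7) * m <= binom_le m r)%N.
    apply: leq_trans large; rewrite leq_mul2r; apply/orP; right.
    apply: leq_trans (_ : _ <= 2 ^ (r + (k + 7)))%N _.
      by rewrite [leqRHS]expnD; apply: leq_mul (leqnn _); apply/ltnW/ltn_expl.
    by rewrite -expnM leq_exp2l //; lia.
  have h3 : (j * (2 ^ (k + 7) * m) <= r * (2 ^ (k + 7) * m))%N.
    by rewrite leq_mul2r (proj2 (andP lejr)) orbT.
  rewrite (addnS k 6) (addnS k 5) !expnS in h1 h2 h3.
  move: (2 ^ (k + 5))%N (binom_le _ _) (binom_le _ _) h1 h2 h3 => P a b; lia.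
(* Squaring gives both halves of the budget the common exponent [2^(k+5)], with one factor [2 ^ D]
   for each. *)
rewrite -(@leq_exp2r _ _ 2) // -expnM mulnC -expnS -addnS.
apply: leq_trans (_ : _ <= (2 ^ (m * (2 * j) + binom_le m (r - j) * 2) * #|low m r k.+1|) ^ 2 ^ (k + 5))%N _.
  by rewrite leq_exp2r ?expn_gt0.
rewrite expnMn -expnM -mulnn; apply: leq_mul; first by rewrite leq_exp2l.
by rewrite (addnS k 4) -addSn.
Qed.

(** * Elementary bounds on powers *)

Lemma bernoulli_ge (R : realFieldType) (x : R) n : -1 <= x -> 1 + n%:R * x <= (1 + x) ^+ n.
Proof.
move=> x1; elim: n => [|n IH]; first by rewrite mul0r addr0.
rewrite exprS; apply: le_trans (_ : _ <= (1 + x) * (1 + n%:R * x)) _; last first.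
  by rewrite ler_wpM2l // addrC -lerBlDr sub0r.
rewrite -natr1; have : 0 <= n%:R * x ^+ 2 by rewrite mulr_ge0 ?sqr_ge0.
nra.
Qed.

(** Bernoulli bounds powers from below; [(1 + u) (1 - u) <= 1] turns this into an upper bound, here
    and in the next two lemmas. *)
Lemma expr_1subV_le (R : realFieldType) n : (0 < n)%N -> 2 * (1 - n%:R^-1) ^+ n <= 1 :> R.
Proof.
move=> n0; have n0' : 0 < n%:R :> R by rewrite ltr0n.
have u0 : 0 < n%:R^-1 :> R by rewrite invr_gt0.
have u1 : n%:R^-1 <= 1 :> R by rewrite invf_le1 // ler1n.
have := @bernoulli_ge R n%:R^-1 n; rewrite divff ?gt_eqF // => /(_ ltac:(lra)) h.
have h2 : ((1 + n%:R^-1) * (1 - n%:R^-1)) ^+ n <= 1 :> R by rewrite exprn_ile1 //; nra.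
apply: le_trans h2; rewrite exprMn ler_wpM2r // exprn_ge0 //; lra.
Qed.

Lemma expr_1addV_le (R : realFieldType) n : (0 < n)%N ->
  (1 + (2 * n)%:R^-1) ^+ (2 * n) <= 4 :> R.
Proof.
move=> n0; set u : R := _^-1.
have nu : n%:R * u = 1 / 2.
  by rewrite /u natrM; field; rewrite pnatr_eq0 -lt0n.
have n1 : 1 <= n%:R :> R by rewrite ler1n.
have u0 : 0 <= u by rewrite invr_ge0.
have u1 : u <= 1 / 2 by nra.
have := @bernoulli_ge R (- u) n ltac:(lra); rewrite mulrN nu => h.
have h2 : ((1 + u) * (1 - u)) ^+ (2 * n) <= 1 by rewrite exprn_ile1 //; nra.
have h3 : 1 / 4 <= (1 - u) ^+ (2 * n).
  rewrite mulnC exprM; nra.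
rewrite exprMn in h2.
have h4 : 0 <= (1 + u) ^+ (2 * n) by rewrite exprn_ge0 //; lra.
nra.
Qed.

Lemma expr_1add_small (R : realFieldType) (u : R) n : 0 <= u -> n%:R * u <= 1 / 2 ->
  (1 + u) ^+ n <= 1 + 2 * (n%:R * u).
Proof.
case: n => [|n] u0 nu; first by rewrite mul0r mulr0 addr0.
have n1 : 1 <= n.+1%:R :> R by rewrite ler1n.
have u1 : u <= 1 / 2 by nra.
have := @bernoulli_ge R (- u) n.+1 ltac:(lra); rewrite mulrN => h.
have h2 : ((1 + u) * (1 - u)) ^+ n.+1 <= 1 by rewrite exprn_ile1 //; nra.
rewrite exprMn in h2.
have h4 : 0 <= (1 + u) ^+ n.+1 by rewrite exprn_ge0 //; lra.
have h5 : 0 <= n.+1%:R * u by rewrite mulr_ge0.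
nra.
Qed.

(** * Contribution of each shell of words *)

(** For biases between [2^-(l+1)] and [2^-l]. Both sides are raised to the power [P], the exponent
    of [card_low_exp] at [q = l + 4], and multiplied by [2^(E P)], so that only integer exponents of
    2 are compared; the gain becomes at most [4^(256 K)]. *)
Lemma biased_shell (R : realFieldType) m r l K : (2 < r)%N -> (2 ^ 24 * r <= m)%N ->
  (1 < l < m %/ 10)%N -> (K <= binom_le m r)%N ->
  #|biased m r l.+1|%:R * (1 + (2 ^ l)%:R^-1) ^+ K * 2 ^+ (2 * m) <= 2 ^+ binom_le m r :> R.
Proof.
move=> r_gt2 lerm /andP[l_gt1 ltl] leK.
pose P := (2 ^ (l + 4 + 4))%N; have P0 : (0 < P)%N by rewrite expn_gt0.
set D := binom_le m r in leK *.
have bound := card_biased m r l.+1 (l + 4).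
have lowP := @card_low_exp m r (l + 4) (ltnW r_gt2) lerm ltac:(lia).
rewrite -/D in bound lowP; set t := (2 * l.+1 + (l + 4).+1)%N in bound.
set E := binom_le (m - t) r in bound.
have tE : t = (3 * l.+1 + 4)%N by rewrite /t; lia.
have dropE : (3 * (1024 * D) <= 4 * (P * E))%N.
  have h := @binom_le_drop (2 ^ 13) m r l.+1 ltac:(lia) ltac:(lia) ltac:(lia).
  rewrite -tE -/E -/D in h.
  have -> : P = (1024 * 2 ^ (l.+1 - 3))%N.
    by rewrite /P (_ : l + 4 + 4 = 10 + (l.+1 - 3))%N ?expnD //; lia.
  by move: (2 ^ (l.+1 - 3))%N h => p; lia.
have largeE : (8 * (m * (t + 2)) <= E)%N.
  have h := @binom_le_large2 (2 ^ 13) (m - t) r r_gt2 ltac:(lia); rewrite -/E in h.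
  have h1 : (2 * t + 4 <= m)%N by lia.
  have h2 : (8 <= m - t)%N by lia.
  have h3 : (m <= 2 * (m - t))%N by lia.
  have h4 : (m * (t + 2) <= 2 * (m - t) * (m - t))%N by apply: leq_mul => //; lia.
  have h5 : (2 * ((m - t) * (m - t)) <= 4 * ((m - t) * (m - t).-1))%N.
    by move: (m - t)%N h2 => n; nia.
  move: (m - t)%N ((m - t).-1)%N h h4 h5 => n n'; lia.
(* Here [E P >= 768 D]. The term [m (t + 2) P] takes at most an eighth of [E P], and the remaining
   [672 D] exceed [D + 512 K]. *)
have expo : ((m * t + D + 2 * m) * P + D + 512 * K <= D * P + E * P)%N.
  have := leq_mul largeE (leqnn P); lia.
rewrite -(@ler_pXn2r _ P) ?nnegrE ?exprn_ge0 //; last first.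
  by rewrite !mulr_ge0 ?exprn_ge0 ?addr_ge0 ?invr_ge0.
rewrite -(ler_pM2r (exprn_gt0 (E * P) (ltr0Sn R 1))) -exprM -exprD.
apply: le_trans (ler_weXn2l _ expo); last by rewrite ler1n.
have -> : (#|biased m r l.+1|%:R * (1 + (2 ^ l)%:R^-1) ^+ K * 2 ^+ (2 * m)) ^+ P * 2 ^+ (E * P)
  = (#|biased m r l.+1|%:R * 2 ^+ E) ^+ P * ((1 + (2 ^ l)%:R^-1) ^+ (K * P))
    * (2 ^+ (2 * m)) ^+ P :> R.
  by rewrite !exprMn -!exprM; ring.
have hu : (1 + (2 ^ l)%:R^-1) ^+ (K * P) <= 2 ^+ (512 * K) :> R.
  have -> : (K * P = (2 * 2 ^ l.-1) * (256 * K))%N.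
    by rewrite -expnS prednK ?(ltnW l_gt1) // /P -addnA expnD; lia.
  rewrite -[in (2 ^ l)%N](prednK (ltnW l_gt1)) expnS (exprM _ (2 * 2 ^ l.-1)).
  rewrite (_ : 512 * K = 2 * (256 * K))%N ?[leRHS](exprM _ 2); last by lia.
  rewrite lerXn2r ?nnegrE ?exprn_ge0 ?addr_ge0 ?invr_ge0 //.
  by apply: le_trans (@expr_1addV_le R _ (expn_gt0 2 l.-1)) _; rewrite -natrX ler_nat.
have hb : (#|biased m r l.+1|%:R * 2 ^+ E) ^+ P <= 2 ^+ ((m * t + D) * P) * 2 ^+ D :> R.
  rewrite -!natrX -!natrM -!natrX ler_nat.
  apply: leq_trans (leq_mul (leqnn _) lowP); rewrite [X in (_ <= X * _)%N]expnM -expnMn.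
  by rewrite leq_exp2r // expnD expnM.
rewrite [leRHS](_ : _ = 2 ^+ ((m * t + D) * P) * 2 ^+ D * 2 ^+ (512 * K) * (2 ^+ (2 * m)) ^+ P).
  rewrite ler_pM2r ?exprn_gt0 //; apply: ler_pM hb hu.
    by rewrite exprn_ge0 // mulr_ge0 ?exprn_ge0.
  by rewrite exprn_ge0 // addr_ge0 ?invr_ge0.
by rewrite -exprM -!exprD; congr (_ ^+ _); lia.
Qed.

(** The number of words is at most [2^(D / 2^(k+4))], while the power is at most
    [2^-(K / 2^(k+1))]. *)
Lemma low_shell (R : realFieldType) m r k K : (1 < r)%N -> (2 ^ 24 * r <= m)%N ->
  (4 < k)%N -> (binom_le m r <= 4 * K)%N ->
  #|low m r k|%:R * (1 - (2 ^ k.+1)%:R^-1) ^+ K <= 1 :> R.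
Proof.
move=> r_gt1 lerm k_gt4 leDK; set v : R := 1 - _.
have v0 : 0 <= v by rewrite subr_ge0 invf_le1 ?ltr0n ?ler1n ?expn_gt0.
have P0 : (0 < 2 ^ (k + 4))%N by rewrite expn_gt0.
rewrite -(expr_le1 P0) ?mulr_ge0 ?exprn_ge0 // exprMn -exprM.
have hv : 2 ^+ (8 * K) * v ^+ (K * 2 ^ (k + 4)) <= 1.
  have -> : (K * 2 ^ (k + 4) = 2 ^ k.+1 * (8 * K))%N by rewrite (addnS k 3) -addSn expnD; lia.
  rewrite (exprM v) -exprMn exprn_ile1 ?mulr_ge0 ?exprn_ge0 //.
  by rewrite expr_1subV_le ?expn_gt0.
apply: le_trans hv; rewrite ler_wpM2r ?exprn_ge0 // -!natrX ler_nat.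
by apply: leq_trans (card_low_exp r_gt1 lerm k_gt4) _; rewrite leq_exp2l //; lia.
Qed.

(** For words of bias at least 1/4 but relative weight above [2^-5]. Dimension 10 is enough: the
    logarithm of their number is at most [10 m + 10 D / 2^13 + D / 2^9], which is below [K / 32]. *)
Lemma biased2_shell (R : realFieldType) m r K : (2 < r)%N -> (2 ^ 24 * r <= m)%N ->
  (binom_le m r <= 4 * K)%N -> #|biased m r 2|%:R * (1 - (2 ^ 5)%:R^-1) ^+ K <= 1 :> R.
Proof.
move=> r_gt2 lerm leDK; set v : R := 1 - _; set D := binom_le m r in leDK *.
have v0 : 0 <= v by rewrite subr_ge0 invf_le1 ?ltr0n ?ler1n ?expn_gt0.
set E := binom_le (m - 10) r.
have [g gE] : exists g, g = (2 ^ 13)%N by exists (2 ^ 13)%N.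
have lossE : (g * D <= g * E + 10 * D)%N.
  have h := @binom_le_loss g (m - 10) r 10 ltac:(lia).
  by move: h; rewrite subnK -/E -/D //; lia.
have largeD : (g * m <= D)%N.
  have h := @binom_le_large2 g m r r_gt2 ltac:(lia).
  have : (m * 2 <= m * m.-1)%N by rewrite leq_mul2l; apply/orP; right; lia.
  rewrite -/D in h; move: (m * m.-1)%N h => x; lia.
pose P := (2 ^ 9)%N; have P0 : (0 < P)%N by rewrite expn_gt0.
have expo : ((m * 10 + D) * P + D <= E * P + 16 * K)%N by rewrite /P; lia.
have bound := card_biased m r 2 5.
have lowP := @card_low_exp m r 5 (ltnW r_gt2) lerm isT.
rewrite (_ : 2 * 2 + 6 = 10)%N // -/D -/E in bound lowP.
rewrite -(expr_le1 P0) ?mulr_ge0 ?exprn_ge0 //.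
rewrite -(ler_pM2r (exprn_gt0 (E * P + 16 * K) (ltr0Sn R 1))) mul1r.
apply: le_trans (ler_weXn2l _ expo); last by rewrite ler1n.
have hv : 2 ^+ (16 * K) * v ^+ (K * P) <= 1.
  have -> : (K * P = 2 ^ 5 * (16 * K))%N by rewrite /P; lia.
  rewrite (exprM v) -exprMn exprn_ile1 ?mulr_ge0 ?exprn_ge0 //.
  by rewrite expr_1subV_le ?expn_gt0.
have hb : (#|biased m r 2|%:R * 2 ^+ E) ^+ P <= 2 ^+ ((m * 10 + D) * P) * 2 ^+ D :> R.
  rewrite -!natrX -!natrM -!natrX ler_nat.
  apply: leq_trans (leq_mul (leqnn _) lowP); rewrite [X in (_ <= X * _)%N]expnM -expnMn.
  by rewrite leq_exp2r // expnD expnM.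
rewrite (_ : _ ^+ P * _ = (#|biased m r 2|%:R * 2 ^+ E) ^+ P * (2 ^+ (16 * K) * v ^+ (K * P))).
  rewrite [leRHS]exprD -[leRHS]mulr1; apply: ler_pM => //.
    by rewrite exprn_ge0 ?mulr_ge0 ?exprn_ge0.
  by rewrite mulr_ge0 ?exprn_ge0.
by rewrite !exprMn !exprM exprD -!exprM; ring.
Qed.

Lemma crossing (P : pred nat) a b : (a <= b)%N -> P a -> ~~ P b ->
  exists i, [/\ (a <= i < b)%N, P i & ~~ P i.+1].
Proof.
move=> /subnK <-; elim: (b - a)%N => [|n IH] Pa nPb; first by rewrite Pa in nPb.
have [Pn|nPn] := boolP (P (n + a)%N).
  by exists (n + a)%N; rewrite leq_addl addSn ltnS leqnn.
have [i [/andP[lei ltin] Pi nPi]] := IH Pa nPn.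
by exists i; rewrite lei addSn ltnS ltnW.
Qed.

Section Weights.
Variables (R : realFieldType) (m r : nat).
Implicit Type f : fn m.

(* [1 + beta_f] in the notation of the header. *)
Definition gain f : R := 2 - 2 * (wt f)%:R / 2 ^+ m.

Let N0 : 0 < 2 ^+ m :> R. Proof. by rewrite exprn_gt0. Qed.

Lemma gain_ge0 f : 0 <= gain f.
Proof. by rewrite subr_ge0 ler_pdivrMr // ler_pM2l // -natrX ler_nat leq_wt. Qed.

Lemma gain_le2 f : gain f <= 2.
Proof. by rewrite gerBl divr_ge0 ?mulr_ge0 ?exprn_ge0. Qed.

Lemma gain_biased f l : f \in RM m r -> f \notin biased m r l -> gain f <= 1 + (2 ^ l)%:R^-1.
Proof.
rewrite inE => -> /=; rewrite -ltnNge -(ltr_nat R) natrD natrM !natrX exprD exprS => h.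
have l0 : 0 < 2 ^+ l :> R by rewrite exprn_gt0.
rewrite ?natrX /gain lerBlDr -(ler_pM2r N0) -(ler_pM2r l0).
have -> : (1 + (2 ^+ l)^-1 + 2 * (wt f)%:R / 2 ^+ m) * 2 ^+ m * 2 ^+ l =
   2 ^+ m * 2 ^+ l + 2 ^+ m + 2 * 2 ^+ l * (wt f)%:R :> R.
  by field; rewrite !gt_eqF.
lra.
Qed.

Lemma gain_low f k : f \in RM m r -> f \notin low m r k -> gain f <= 2 * (1 - (2 ^ k)%:R^-1).
Proof.
rewrite inE => -> /=; rewrite -ltnNge -(ltr_nat R) natrM !natrX => h.
have l0 : 0 < 2 ^+ k :> R by rewrite exprn_gt0.
rewrite ?natrX /gain mulrBr mulr1 lerD2l lerN2 -mulrA ler_pM2l //.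
by rewrite ler_pdivlMr // mulrC ler_pdivrMr // mulrC ltW.
Qed.

Lemma gain_expr_le K K' f (u : R) : (K <= K')%N -> 1 <= u -> gain f <= u ->
  gain f ^+ K <= u ^+ K'.
Proof.
move=> leK u1 leu; apply: le_trans (_ : _ <= u ^+ K) _.
  by rewrite lerXn2r ?nnegrE ?gain_ge0 // (le_trans _ u1).
exact: ler_weXn2l.
Qed.

(** Every word falls into some shell: [crossing] finds a threshold of bias or, for bias at least
    1/4, of weight between which it lies. The exponent may grow to [K'] because all bounds on the
    gain are at least 1. *)
Lemma gain_shells K K' L f : (K <= K')%N -> (2 <= L)%N -> (4 < r)%N -> f \in RM m r ->
  gain f ^+ K <= (1 + (2 ^ L)%:R^-1) ^+ K' +
    (\sum_(2 <= l < L) (f \in biased m r l.+1)%:R * (1 + (2 ^ l)%:R^-1) ^+ K' +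
    ((f \in biased m r 2)%:R * (2 * (1 - (2 ^ 5)%:R^-1)) ^+ K' +
    (\sum_(5 <= k < r.+1) (f \in low m r k)%:R * (2 * (1 - (2 ^ k.+1)%:R^-1)) ^+ K' +
    (f == 0)%:R * 2 ^+ K'))).
Proof.
move=> leK L2 r4 fRM.
have uge1 l : 1 <= 1 + (2 ^ l)%:R^-1 :> R by rewrite lerDl invr_ge0.
have vge1 k : 1 <= 2 * (1 - (2 ^ k.+1)%:R^-1) :> R.
  rewrite mulrBr mulr1 -addrA lerDl subr_ge0 natrX exprS invfM mulrA divff ?mul1r ?pnatr_eq0 //.
  by rewrite invf_le1 ?exprn_gt0 // exprn_ege1 ?ler1n.
have term1 : 0 <= (1 + (2 ^ L)%:R^-1) ^+ K' :> R by rewrite exprn_ge0 // (le_trans _ (uge1 L)).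
have T2 l : 0 <= (f \in biased m r l.+1)%:R * (1 + (2 ^ l)%:R^-1) ^+ K' :> R.
  by rewrite mulr_ge0 ?exprn_ge0 // (le_trans _ (uge1 l)).
have term2 : 0 <= \sum_(2 <= l < L) (f \in biased m r l.+1)%:R * (1 + (2 ^ l)%:R^-1) ^+ K' :> R.
  by apply: sumr_ge0.
have term3 : 0 <= (f \in biased m r 2)%:R * (2 * (1 - (2 ^ 5)%:R^-1)) ^+ K' :> R.
  by rewrite mulr_ge0 ?exprn_ge0 // (le_trans _ (vge1 4)).
have T4 k : 0 <= (f \in low m r k)%:R * (2 * (1 - (2 ^ k.+1)%:R^-1)) ^+ K' :> R.
  by rewrite mulr_ge0 ?exprn_ge0 // (le_trans _ (vge1 k)).
have term4 : 0 <= \sum_(5 <= k < r.+1) (f \in low m r k)%:R * (2 * (1 - (2 ^ k.+1)%:R^-1)) ^+ K' :> R.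
  by apply: sumr_ge0.
have term5 : 0 <= (f == 0)%:R * 2 ^+ K' :> R by rewrite mulr_ge0 ?exprn_ge0.
have [fL|nfL] := boolP (f \in biased m r L); last first.
  apply: le_trans (gain_expr_le leK (uge1 L) (gain_biased fRM nfL)) _.
  by rewrite lerDl !addr_ge0.
have [f2|nf2] := boolP (f \in biased m r 2); last first.
  have [||i [/andP[i2 iL] nfi]] := @crossing (fun l => f \notin biased m r l) _ _ L2 => //.
    by rewrite negbK.
  rewrite negbK => fi.
  apply: le_trans (gain_expr_le leK (uge1 i) (gain_biased fRM nfi)) _.
  apply: le_trans (_ : _ <= \sum_(2 <= l < L) (f \in biased m r l.+1)%:R * (1 + (2 ^ l)%:R^-1) ^+ K') _.
    rewrite (bigD1_seq i) ?iota_uniq ?mem_index_iota ?i2 //= fi mul1r lerDl.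
    by apply: sumr_ge0.
  rewrite (negPf nf2) in term3; by rewrite addrCA lerDl !addr_ge0.
rewrite f2 mul1r in term3; rewrite mul1r.
have [f5|nf5] := boolP (f \in low m r 5); last first.
  apply: le_trans (gain_expr_le leK (vge1 4) (gain_low fRM nf5)) _.
  by rewrite 2!addrA addrAC addrC -addrA lerDl !addr_ge0.
have [/low_eq0 f0 | nfr] := boolP (f \in low m r r.+1).
  have -> : (f == 0) = true by rewrite f0 eqxx.
  rewrite mul1r; apply: le_trans (gain_expr_le leK _ (gain_le2 f)) _; first by rewrite ler1n.
  by rewrite !addrA lerDr !addr_ge0.
have [||k [/andP[k5 kr] fk nfk]] := @crossing (fun k => f \in low m r k) _ _ (leqW r4) => //.
apply: le_trans (gain_expr_le leK (vge1 k) (gain_low fRM nfk)) _.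
apply: le_trans (_ : _ <= \sum_(5 <= k < r.+1) (f \in low m r k)%:R * (2 * (1 - (2 ^ k.+1)%:R^-1)) ^+ K') _.
  rewrite (bigD1_seq k) ?iota_uniq ?mem_index_iota ?k5 //= fk mul1r lerDl.
  by apply: sumr_ge0.
by rewrite !addrA addrAC lerDr !addr_ge0.
Qed.

End Weights.

(** Fewer than [m] shells of bias contribute [2^(D-2m)] each. The words of bias at least 1/4, at
    most [r] shells of weight and the zero word contribute [2 ^ K'] each, whence [r.+2]. *)
Lemma unrecoverable_shells (R : realFieldType) m r d K K' : (r + d < m)%N -> (4 < r)%N ->
  (2 ^ 24 * r <= m)%N -> (K <= K' <= binom_le m r)%N -> (binom_le m r <= 4 * K')%N ->
  1 - (#|[set Z : {set point m} | (#|Z| == K) && erasure_recoverable d Z]|)%:R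
      / (#|[set Z : {set point m} | #|Z| == K]|)%:R <=
  (1 + (2 ^ (m %/ 10))%:R^-1) ^+ K' - 1 + m%:R / 2 ^+ (2 * m)
    + r.+2%:R * 2 ^+ K' / 2 ^+ binom_le m r :> R.
Proof.
move=> ltm r_gt4 lerm /andP[leK leK'] leD; set L := (m %/ 10)%N; set D := binom_le m r in leK' leD *.
have leKm : (K <= 2 ^ m)%N by rewrite (leq_trans leK) // (leq_trans leK') // binom_le_max.
have L2 : (2 <= L)%N by rewrite /L; lia.
have D0 : 0 < 2 ^+ D :> R by rewrite exprn_gt0.
apply: le_trans (unrecoverable_bound R ltm leKm) _.
have cardC : #|RM m r|%:R = 2 ^+ D :> R by rewrite card_RM natrX.
rewrite cardC -[leRHS]addrA [leRHS]addrAC; apply: lerD => //.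
rewrite ler_pdivrMr //.
rewrite (eq_bigr (fun f => gain R f ^+ K)) //.
apply: le_trans (ler_sum _ (fun f fRM => gain_shells R leK L2 r_gt4 fRM)) _.
rewrite 4!big_split /= exchange_big /= [X in _ + (_ + (_ + (X + _)))]exchange_big /=.
have sum_mem (A : {set fn m}) c : A \subset RM m r ->
    \sum_(f in RM m r) (f \in A)%:R * c = #|A|%:R * c :> R.
  move=> sA; rewrite -mulr_suml; congr (_ * c).
  rewrite -sum1_card natr_sum (bigID (mem A)) /= [X in _ + X]big1 ?addr0.
    apply: eq_big => [f|f /andP[_ ->] //]; rewrite andb_idl //.
    exact: (subsetP sA).
  by move=> f /andP[_ /negPf ->].
have lowS k : low m r k \subset RM m r by apply/subsetP => f; rewrite inE => /andP[].
have biasedS l : biased m r l \subset RM m r by apply/subsetP => f; rewrite inE => /andP[].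
rewrite sumr_const -[_ *+ #|_|]mulr_natr cardC sum_mem //.
rewrite [leRHS]mulrDl lerD2l [leRHS]mulrDl.
have -> : r.+2%:R * 2 ^+ K' / 2 ^+ D * 2 ^+ D = 2 ^+ K' + (r%:R * 2 ^+ K' + 2 ^+ K') :> R.
  by rewrite divfK ?gt_eqF // -2!natr1; ring.
apply: lerD.
  apply: le_trans (_ : _ <= \sum_(2 <= l < L) 2 ^+ D / 2 ^+ (2 * m)) _.
    rewrite [leLHS]big_nat [leRHS]big_nat; apply: ler_sum => l lL; rewrite sum_mem //.
    by rewrite ler_pdivlMr ?exprn_gt0 //; apply: biased_shell => //; apply: ltnW (ltnW _).
  rewrite sumr_const_nat -[leLHS]mulr_natl [leRHS]mulrAC mulrA ler_pM2r ?invr_gt0 ?exprn_gt0 //.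
  by rewrite ler_pM2r // ler_nat /L; lia.
have shell a v : a * v ^+ K' <= 1 -> a * (2 * v) ^+ K' <= 2 ^+ K' :> R.
  by move=> h; rewrite exprMn mulrCA ler_piMr // exprn_ge0.
apply: lerD; first by apply/shell/biased2_shell => //; lia.
apply: lerD.
  apply: le_trans (_ : _ <= \sum_(5 <= k < r.+1) 2 ^+ K') _.
    rewrite [leLHS]big_nat [leRHS]big_nat; apply: ler_sum => k /andP[k5 _]; rewrite sum_mem //.
    by apply/shell/low_shell => //; lia.
  rewrite sumr_const_nat -[leLHS]mulr_natl ler_pM2r ?exprn_gt0 // ler_nat; lia.
rewrite -mulr_suml ler_piMl ?exprn_ge0 //.
rewrite (bigD1 (0 : fn m)) ?RM0 //= eqxx big1 ?addr0 //.
by move=> f /andP[_ /negPf ->].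
Qed.

(** * Size of the error terms *)

(** Shows that a bias of [2^-(m/10)] is negligible: times [K <= D] it is at most [1 / m]. *)
Lemma mul_binom_le_small m r : (4 < r)%N -> (2 ^ 24 * r <= m)%N ->
  (m * binom_le m r <= 2 ^ (m %/ 10))%N.
Proof.
move=> r_gt4 lerm; have hD := @binom_le_small m r ltac:(lia).
have hm : (m <= 2 ^ (m %/ 40))%N.
  have h6 : (m %/ 40 - 6 < 2 ^ (m %/ 40 - 6))%N by apply: ltn_expl.
  have -> : (m %/ 40 = (m %/ 40 - 6) + 6)%N by lia.
  rewrite expnD; move: (2 ^ _)%N h6 => x; lia.
apply: leq_trans (leq_mul hm hD) _; rewrite -expnD leq_exp2l //; lia.
Qed.

Lemma mul_le_binom_le m r : (4 < r)%N -> (2 ^ 24 * r <= m)%N ->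
  (r.+2 * m <= binom_le m r)%N.
Proof.
move=> r_gt4 lerm.
apply: leq_trans (@binom_le_large1 (2 ^ 13) m r ltac:(lia) ltac:(lia)).
rewrite leq_mul2r; apply/orP; right; have h : (r < 2 ^ r)%N by apply: ltn_expl.
apply: leq_trans (_ : _ <= 2 ^ (r + 2))%N _; first by rewrite expnD; lia.
by rewrite -expnM leq_exp2l //; lia.
Qed.

Lemma unbiased_term_le (R : realFieldType) m L K : (1 < m)%N -> (m * K <= 2 ^ L)%N ->
  (1 + (2 ^ L)%:R^-1) ^+ K - 1 <= 2 / m%:R :> R.
Proof.
move=> m_gt1 leK; have m0 : 0 < m%:R :> R by rewrite ltr0n ltnW.
have hu : K%:R * (2 ^ L)%:R^-1 <= m%:R^-1 :> R.
  by rewrite ler_pdivrMr ?ltr0n ?expn_gt0 // mulrC ler_pdivlMr // -natrM ler_nat mulnC.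
have mhalf : m%:R^-1 <= 1 / 2 :> R.
  by rewrite -div1r ler_pdivrMr // mulrAC ler_pdivlMr // mul1r mul1r ler_nat.
have := @expr_1add_small R (2 ^ L)%:R^-1 K.
rewrite invr_ge0 ler0n => /(_ isT (le_trans hu mhalf)); lra.
Qed.

(** Linear growth of the power suffices: [2^(D-K) >= D - K >= e D >= e s m]. *)
Lemma low_term_le (R : realFieldType) m s D K (e : R) : (0 < m)%N -> (K <= D)%N -> (s * m <= D)%N ->
  0 < e -> K%:R <= (1 - e) * D%:R -> s%:R * 2 ^+ K / 2 ^+ D <= e^-1 / m%:R.
Proof.
move=> m_gt0 leKD lesm e0 leK; have m0 : 0 < m%:R :> R by rewrite ltr0n.
have hDK : e * D%:R <= 2 ^+ (D - K).
  apply: le_trans (_ : _ <= (D - K)%:R) _; first by rewrite natrB //; lra.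
  by rewrite -natrX ler_nat ltnW // ltn_expl.
have -> : s%:R * 2 ^+ K / 2 ^+ D = s%:R / 2 ^+ (D - K) :> R.
  by apply/eqP; rewrite eqr_div ?expf_neq0 ?pnatr_eq0 // -mulrA -exprD subnKC.
rewrite ler_pdivrMr ?exprn_gt0 // -ler_pdivrMl ?divr_gt0 ?invr_gt0 //.
by apply: le_trans hDK; rewrite invfM !invrK -mulrA ler_pM2l // mulrC -natrM ler_nat.
Qed.

Lemma shells_le (R : realFieldType) m r (e : R) K : (4 < r)%N -> (2 ^ 24 * r <= m)%N ->
  0 < e -> K%:R <= (1 - e) * (binom_le m r)%:R ->
  (1 + (2 ^ (m %/ 10))%:R^-1) ^+ K - 1 + m%:R / 2 ^+ (2 * m)
    + r.+2%:R * 2 ^+ K / 2 ^+ binom_le m r <= (3 + e^-1) / m%:R.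
Proof.
move=> r_gt4 lerm e0 leK; have m_gt1 : (1 < m)%N by lia.
have m0 : 0 < m%:R :> R by rewrite ltr0n ltnW.
have leKD : (K <= binom_le m r)%N.
  by rewrite -(ler_nat R) (le_trans leK) // ler_piMl ?ler0n // gerBl ltW.
have -> : (3 + e^-1) / m%:R = 2 / m%:R + 1 / m%:R + e^-1 / m%:R by ring.
apply: lerD; last first.
  by apply: low_term_le leK => //; [apply: ltnW | apply: mul_le_binom_le].
apply: lerD.
  apply: unbiased_term_le => //; apply: leq_trans (mul_binom_le_small r_gt4 lerm).
  by rewrite leq_mul2l leKD orbT.
rewrite ler_pdivrMr ?exprn_gt0 // mulrAC ler_pdivlMr // mul1r -natrM -natrX ler_nat.
by rewrite mulnC expnM leq_mul // ltnW // ltn_expl.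
Qed.

Lemma floor_nat (R : realType) (x : R) : 0 <= x ->
  `|Num.floor x|%N%:R <= x < `|Num.floor x|%N%:R + 1.
Proof.
move=> x0; have -> : `|Num.floor x|%N%:R = (Num.floor x)%:~R :> R.
  by rewrite -[in RHS](@gez0_abs (Num.floor x)) ?floor_ge0.
by have := floor_itv x; rewrite intrD.
Qed.

Lemma le_quarter_floor (R : realType) (e : R) D : e <= 1 / 2 -> (4 <= D)%N ->
  (D <= 4 * `|Num.floor ((1 - e) * D%:R)|)%N.
Proof.
move=> e2; rewrite -(ler_nat R) => D4.
have e2' : 1 / 2 <= 1 - e by lra.
have h : 1 / 2 * D%:R <= (1 - e) * D%:R by rewrite ler_wpM2r.
have /andP[_] := @floor_nat R ((1 - e) * D%:R) ltac:(lra).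
move: `|_|%N => K hK; rewrite -(ler_nat R) natrM; lra.
Qed.

Theorem theorem1p2 (R : realType) :
  exists gamma0 : R, 0 < gamma0 /\
  forall eps : R, 0 < eps -> eps < 1 ->
  forall m d : nat -> nat,
    (forall n, (m n)%:R * (1 - gamma0) < (d n)%:R) ->
    (forall B : nat, exists N : nat, forall n, (N <= n)%N -> (B <= m n - d n)%N) ->
    forall delta : R, 0 < delta ->
    exists N : nat, forall n, (N <= n)%N ->
      1 - delta <= prob_recoverable R (m n) (d n) (K_of eps (m n) (d n)).
Proof.
exists (2 ^+ 24)^-1; split; first by rewrite invr_gt0 exprn_gt0.
move=> eps eps0 eps1 m d hmd hinf delta delta0.
(* For [eps] near 1, [K] is too small against [D] for the shell bounds. Capping [eps] at 1/2 gives
   [K' >= K] with [D <= 4 K']. *)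
pose e := Num.min eps (1 / 2).
have e0 : 0 < e by rewrite lt_min eps0 divr_gt0.
have e_eps : e <= eps by rewrite ge_min lexx.
have e_half : e <= 1 / 2 by rewrite ge_min lexx orbT.
have c0 : 0 <= (3 + e^-1) / delta by rewrite divr_ge0 ?addr_ge0 ?invr_ge0 ?ltW.
pose B := `|Num.floor ((3 + e^-1) / delta)|%N.
(* [B] makes [(3 + e^-1) / m] at most [delta]; the extra 7 ensures [4 < r]. *)
have [N hN] := hinf (B + 7)%N; exists N => n /hN.
move: (m n) (d n) (hmd n) => {hmd hinf hN} {}m {}d hmd hB.
pose r := (m - d - 1)%N; rewrite /K_of -/r; set D := binom_le m r.
have [ltrm r_gt4 ltdm ltBm] : [/\ (r + d < m)%N, (4 < r)%N, (d <= m)%N & (B < m)%N].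
  by move: hB; rewrite /r; move: B => B'; clear; split; lia.
(* The rate hypothesis with [gamma0 = 2^-24] says [2 ^ 24 (m - d) < m]. *)
have lerm : (2 ^ 24 * r <= m)%N.
  apply: leq_trans (_ : _ <= 2 ^ 24 * (m - d))%N _.
    by rewrite leq_mul2l /r leq_subr orbT.
  rewrite -(ler_nat R) natrM natrB // natrX; apply: ltW.
  by move: hmd; rewrite mulrBr mulr1 ltrBlDr -ltrBlDl ltr_pdivlMr ?exprn_gt0 // mulrC.
have D4 : (4 <= D)%N.
  apply: leq_trans (mul_le_binom_le r_gt4 lerm).
  apply: leq_trans (leq_pmulr _ (leq_ltn_trans (leq0n B) ltBm)).
  exact: leq_trans (ltnW r_gt4) (leqW (leqnSn r)).
set K := `|_|%N; pose K' := `|Num.floor ((1 - e) * D%:R)|%N.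
have e_le1 : 0 <= 1 - e by rewrite subr_ge0 (le_trans e_eps) ?ltW.
have /andP[K1 _] : K%:R <= (1 - eps) * D%:R < K%:R + 1.
  by apply: floor_nat; rewrite mulr_ge0 // subr_ge0 ltW.
have /andP[K1' K2'] : K'%:R <= (1 - e) * D%:R < K'%:R + 1.
  by apply: floor_nat; rewrite mulr_ge0.
have leKK' : (K <= K')%N.
  rewrite -ltnS -(ltr_nat R) -natr1; apply: le_lt_trans K1 (le_lt_trans _ K2').
  by rewrite ler_wpM2r // lerD2l lerN2.
have leK'D : (K' <= D)%N.
  by rewrite -(ler_nat R) (le_trans K1') // ler_piMl ?ler0n // gerBl ltW.
have leKD : (K <= K' <= D)%N by rewrite leKK'.
rewrite lerBlDl -lerBlDr /prob_recoverable.
apply: le_trans (unrecoverable_shells R ltrm r_gt4 lerm leKD (le_quarter_floor e_half D4)) _.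
apply: le_trans (shells_le r_gt4 lerm e0 K1') _.
have m0 : 0 < m%:R :> R by rewrite ltr0n (leq_ltn_trans (leq0n B)).
rewrite ler_pdivrMr // mulrC -ler_pdivrMr //.
have /andP[_ /ltW hB2] := floor_nat c0; apply: le_trans hB2 _.
by rewrite natr1 ler_nat.
Qed.
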